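(* Let $H$ be a connected (Lie) subgroup of $I^o(\mathbb{L}^3)$ acting on $\mathbb{L}^3$ with cohomogeneity one. Then the action of $H$ is orbit-equivalent to the action on $\mathbb{L}^3$ of one of the following groups: (1) $\mathbb{R}^2$, $\mathbb{L}^2$ or $\mathbb{W}^2$; (2) $K\times\mathbb{R}e_3$, $A\times\mathbb{R}e_1$, $N\times\ell$, $N_1\times\ell$, or $A_\lambda\ltimes\ell$ for some $\lambda\geq 0$; (3) $SO^o_{2,1} = KAN$ or $AN$.
   Context: $\mathbb{L}^3$ is $\mathbb{R}^3$ with standard basis $e_1,e_2,e_3$ and inner product $\langle u,v\rangle = u_1v_1+u_2v_2-u_3v_3$. $I(\mathbb{L}^3) = O_{2,1}\ltimes\mathbb{L}^3$ is its isometry group, with $(x,u)$ acting by $p\mapsto xp+u$; its identity component is $I^o(\mathbb{L}^3) = SO^o_{2,1}\ltimes\mathbb{L}^3$, where $SO^o_{2,1}$ is the identity component of $O_{2,1}$. Its Lie algebra is $\mathfrak{so}_{2,1}\oplus\mathbb{L}^3$ with bracket $[X+u,Y+v] = (XY-YX)+(Xv-Yu)$, and $\operatorname{Exp}$ denotes the Lie group exponential map. An action is of cohomogeneity one if the minimal codimension of its orbits is one. Two isometric actions on $\mathbb{L}^3$ are orbit-equivalent if there is an isometry of $\mathbb{L}^3$ mapping the orbits of one action onto the orbits of the other. Put $$Y_{\mathfrak{k}} = \begin{pmatrix}0&-1&0\\1&0&0\\0&0&0\end{pmatrix},\quad Y_{\mathfrak{a}} = \begin{pmatrix}0&0&0\\0&0&-1\\0&-1&0\end{pmatrix},\quad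 Y_{\mathfrak{n}} = \begin{pmatrix}0&1&1\\-1&0&0\\1&0&0\end{pmatrix},$$ and let $K,A,N$ be the connected one-dimensional subgroups of $SO^o_{2,1}$ with Lie algebras $\mathbb{R}Y_{\mathfrak{k}}$, $\mathbb{R}Y_{\mathfrak{a}}$, $\mathbb{R}Y_{\mathfrak{n}}$ respectively; $SO^o_{2,1} = KAN$ is an Iwasawa decomposition and $AN$ is a subgroup. Subspaces of $\mathbb{L}^3$ are regarded as groups of translations: $\mathbb{R}^2 = \mathbb{R}e_1\oplus\mathbb{R}e_2$, $\mathbb{L}^2 = \mathbb{R}e_2\oplus\mathbb{R}e_3$, $\mathbb{W}^2 = \mathbb{R}e_1\oplus\mathbb{R}(e_2-e_3)$, $\ell = \mathbb{R}(e_2-e_3)$. $K\times\mathbb{R}e_3$, $A\times\mathbb{R}e_1$ and $N\times\ell$ are the connected subgroups of $I^o(\mathbb{L}^3)$ generated by the two indicated factors. For $\lambda\geq0$, $A_\lambda = \operatorname{Exp}(\mathbb{R}(Y_{\mathfrak{a}}+\lambda e_1))$ and $N_\lambda = \operatorname{Exp}(\mathbb{R}(Y_{\mathfrak{n}}+\lambda e_3))$; $A_\lambda\ltimes\ell$ and $N_\lambda\times\ell$ are the connected subgroups of $I^o(\mathbb{L}^3)$ with Lie algebras $\mathbb{R}(Y_{\mathfrak{a}}+\lambda e_1)\oplus\ell$ and $\mathbb{R}(Y_{\mathfrak{n}}+\lambda e_3)\oplus\ell$ respectively. *)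

(* Defs.v *)
From HB Require Import structures.
From mathcomp Require Import all_boot all_order all_algebra.
From mathcomp Require Import all_classical all_reals all_analysis.
Set Implicit Arguments.
Unset Strict Implicit.
Unset Printing Implicit Defensive.
Import Order.TTheory GRing.Theory Num.Theory.
Import numFieldNormedType.Exports.
Local Open Scope classical_set_scope.
Local Open Scope ring_scope.

(* A pair (x, u) stands both for the affine map p |-> x p + u and for the      *)
(* element x + u of gl_3 (+) L^3.                                              *)
Notation aff R := ('M[R]_3 * 'cV[R]_3)%type.

Section Minkowski.
Variable R : realType.
Implicit Types (x : 'M[R]_3) (p u v : 'cV[R]_3) (g X Y : aff R) (G H : set (aff R)).

Definition lorentz u v : R := u 0 0 * v 0 0 + u 1 0 * v 1 0 - u 2 0 * v 2 0.

Definition e1 : 'cV[R]_3 := delta_mx 0 0.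
Definition e2 : 'cV[R]_3 := delta_mx 1 0.
Definition e3 : 'cV[R]_3 := delta_mx 2 0.

Definition O21 : set 'M[R]_3 :=
  [set x | forall u v, lorentz (x *m u) (x *m v) = lorentz u v].
Definition SOo21 : set 'M[R]_3 := connected_component O21 1%:M.

Definition aff1 : aff R := (1%:M, 0).
Definition affM g1 g2 : aff R := (g1.1 *m g2.1, g1.1 *m g2.2 + g1.2).
Definition affV g : aff R := (invmx g.1, - (invmx g.1 *m g.2)).
Definition act g p : 'cV[R]_3 := g.1 *m p + g.2.

Definition Isom : set (aff R) := [set g | O21 g.1].
Definition Isomo : set (aff R) := [set g | SOo21 g.1].

Definition subgroup H :=
  [/\ H `<=` Isom, H aff1,
      forall g1 g2, H g1 -> H g2 -> H (affM g1 g2) &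
      forall g, H g -> H (affV g)].

Definition generated G : set (aff R) := smallest subgroup G.

Definition bracket X Y : aff R :=
  (X.1 *m Y.1 - Y.1 *m X.1, X.1 *m Y.2 - Y.1 *m X.2).

(* Differentiability at 0 of a homomorphism R -> Isom makes it smooth.         *)
Definition one_param (gam : R -> aff R) X :=
  [/\ forall t, Isom (gam t),
      forall s t, gam (s + t) = affM (gam s) (gam t),
      is_derive (0 : R) (1 : R) (fun t => (gam t).1) X.1 &
      is_derive (0 : R) (1 : R) (fun t => (gam t).2) X.2].

(* The image of h under the exponential map of Isom, where Exp X is gam 1 for  *)
(* the (unique) one-parameter subgroup gam with gam'(0) = X.                   *)
Definition Exp (h : {vspace aff R}) : set (aff R) :=
  [set g | exists gam X, [/\ X \in h, one_param gam X & g = gam 1]].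

(* { X | Exp (t X) is in H for all t }                                         *)
Definition lie_algebra H : set (aff R) :=
  [set X | exists2 gam, one_param gam X & forall t, H (gam t)].

(* The connected subgroup of Isom with Lie algebra h.                          *)
Definition connected_subgroup (h : {vspace aff R}) : set (aff R) :=
  generated (Exp h).

(* Connected Lie subgroups need not be closed, so this is not a condition on   *)
(* the topology induced by Isom. The definition is the usual one for matrix    *)
(* groups (B. C. Hall, Lie Groups, Lie Algebras, and Representations, 2nd ed., *)
(* Definition 5.19): the Lie algebra of H is a Lie subalgebra, and its         *)
(* exponentials generate H.                                                    *)
Definition connected_Lie_subgroup H :=
  subgroup H /\
  exists h : {vspace aff R},
    [/\ lie_algebra H = [set` h],
        forall X Y, X \in h -> Y \in h -> bracket X Y \in h &
        H = connected_subgroup h].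

Definition orbit H p : set 'cV[R]_3 := [set act g p | g in H].
Definition orbits H : set (set 'cV[R]_3) := range (orbit H).

(* The tangent space at p of the orbit through p, viewed as the immersed       *)
(* submanifold H / H_p: the values at p of the fundamental vector fields, i.e. *)
(* the initial velocities of the curves t |-> Exp (t X) p.                     *)
Definition orbit_tangent H p : set 'cV[R]_3 :=
  [set X.1 *m p + X.2 | X in lie_algebra H].

Definition orbit_codim H p (c : nat) :=
  exists2 V : {vspace 'cV[R]_3},
    orbit_tangent H p = [set` V] & (\dim V + c = 3)%N.

Definition cohomogeneity H (c : nat) :=
  (exists p, orbit_codim H p c) /\
  (forall p d, orbit_codim H p d -> (c <= d)%N).

Definition orbit_equivalent H1 H2 :=
  exists2 g, Isom g & [set act g @` O | O in orbits H1] = orbits H2.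

Definition mx3 (s : seq (seq R)) : 'M[R]_3 :=
  \matrix_(i, j) nth 0 (nth [::] s i) j.

Definition Yk : 'M[R]_3 := mx3 [:: [:: 0; -1; 0]; [:: 1; 0; 0]; [:: 0; 0; 0]].
Definition Ya : 'M[R]_3 := mx3 [:: [:: 0; 0; 0]; [:: 0; 0; -1]; [:: 0; -1; 0]].
Definition Yn : 'M[R]_3 := mx3 [:: [:: 0; 1; 1]; [:: -1; 0; 0]; [:: 1; 0; 0]].

Definition translations (V : {vspace 'cV[R]_3}) : set (aff R) :=
  [set (1%:M, v) | v in [set` V]].
Definition linear_group (L : set 'M[R]_3) : set (aff R) :=
  [set (x, 0) | x in L].

Definition R2 : {vspace 'cV[R]_3} := (<[e1]> + <[e2]>)%VS.
Definition L2 : {vspace 'cV[R]_3} := (<[e2]> + <[e3]>)%VS.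
Definition W2 : {vspace 'cV[R]_3} := (<[e1]> + <[e2 - e3]>)%VS.
Definition ell : {vspace 'cV[R]_3} := <[e2 - e3]>%VS.

Definition grpK : set (aff R) := connected_subgroup <[(Yk, 0)]>.
Definition grpA : set (aff R) := connected_subgroup <[(Ya, 0)]>.
Definition grpN : set (aff R) := connected_subgroup <[(Yn, 0)]>.

Definition K_Re3 : set (aff R) := generated (grpK `|` translations <[e3]>).
Definition A_Re1 : set (aff R) := generated (grpA `|` translations <[e1]>).
Definition N_ell : set (aff R) := generated (grpN `|` translations ell).
Definition Nlam_ell (lam : R) : set (aff R) :=
  connected_subgroup (<[(Yn, lam *: e3)]> + <[(0%R, e2 - e3)]>)%VS.
Definition Alam_ell (lam : R) : set (aff R) :=
  connected_subgroup (<[(Ya, lam *: e1)]> + <[(0%R, e2 - e3)]>)%VS.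
Definition AN : set (aff R) := [set affM a n | a in grpA & n in grpN].

End Minkowski.

Arguments SOo21 R : clear implicits.
Arguments Isom R : clear implicits.
Arguments Isomo R : clear implicits.
Arguments K_Re3 R : clear implicits.
Arguments A_Re1 R : clear implicits.
Arguments N_ell R : clear implicits.
Arguments AN R : clear implicits.

(* Main.v *)
Require Import Defs.
From HB Require Import structures.
From mathcomp Require Import all_boot all_order all_algebra.
From mathcomp Require Import all_classical all_reals all_analysis.
From mathcomp Require Import ring lra.
Import Order.TTheory GRing.Theory Num.Theory.
Import numFieldNormedType.Exports.
Local Open Scope classical_set_scope.
Local Open Scope ring_scope.

Set Implicit Arguments.
Unset Strict Implicit.
Unset Printing Implicit Defensive.

(** Everything is decided on the Lie algebra [S] of [H]. The Lorentz cross
product [y, p |-> cross y p] identifies so(2,1) with L^3 ([Xi y] is the matrix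
of [cross y]), so an element of [S] is a pair [(Xi y, v)] whose velocity field
is [p |-> cross y p + v]. Cohomogeneity one says that no velocity space is
3-dimensional while one of them is a plane. Let [T] be the space of the
translations [v] with [(0, v)] in [S].

- If [T] contains a plane, with Lorentz normal [n], then all velocities lie in
  it: a transversal velocity at one point, added to the plane, would fill L^3.
  Hence [lorentz n] is constant on orbits, the orbits are the translates of the
  plane, and the causal type of [n] selects R^2, L^2 or W^2 ([plane_case]).
- If [T] is a line [R u], it is invariant under the linear parts [cross y]. For
  [u] not null this forces [y] in [R u], which gives K x R e3 and A x R e1
  ([line_e3_case], [line_e1_case]). For [u = nu = e2 - e3] it forces [y] in the
  plane spanned by [e1] and [nu]; if all of that plane occurred, the velocities
  at some point would fill L^3 ([open_orbit_W2]), so [y] runs through a single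
  line, which is conjugate to [R e1] or equal to [R nu] ([null_line_case]). The
  translation part is then reduced modulo the image of [Xi y] by moving the
  origin, and what survives, a multiple of [e1] or [e3], is normalised with
  reflections and boosts ([Alam_case], [Nlam_case]).
- If [T = 0], then [S] is the graph of a cocycle over a subalgebra [L] of
  so(2,1), and the plane of velocities makes [L] at least 2-dimensional. For
  independent [y1], [y2] in [L] the vector [n = cross y1 y2] is in [L] and is
  normal to their plane. So either [L] is everything, or [L] is that plane and
  [n] is null, in which case [L] is conjugate to the Lie algebra of AN. In both
  cases the cocycle is a coboundary, and moving the origin makes [H] linear
  ([so21_case], [borel_case]).

The Lie group structure and the cohomogeneity are invariant under conjugation by
isometries ([lie_group_conj], [cohom1_conj]), and O(2,1) moves every nonzero
vector to a multiple of [e3], [e1] or [nu] ([O21_normal_form]), so these are the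
only positions to treat.

The passage from Lie algebras to groups needs no general exponential map. A
one-parameter group [gam] with generator [X] solves [gam' = gam X], so it
multiplies an eigenvector of [X] by an exponential ([one_param_eigen]) and keeps
[lorentz n] constant along its orbits when the velocities are orthogonal to [n]
([one_param_lorentz]). This bounds [H] from above inside an explicitly defined
group; explicit rotations, boosts and unipotent matrices bound it from below. *)

(** * Coordinates, the Lorentz cross product and O(2,1) *)

Section Coordinates.
Variable R : realType.
Implicit Types (x : 'M[R]_3) (p u v w : 'cV[R]_3).

Definition vec3 (a b c : R) : 'cV[R]_3 := \col_i nth 0 [:: a; b; c] i.

Lemma I3P (i : 'I_3) : [\/ i = 0, i = 1 | i = 2].
Proof.
by case: i => [[|[|[|i]]] Hi] //; [apply: Or31|apply: Or32|apply: Or33];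
  apply: val_inj.
Qed.

Lemma mulmx3E m n (A : 'M[R]_(m, 3)) (B : 'M[R]_(3, n)) i j :
  (A *m B) i j = A i 0 * B 0 j + A i 1 * B 1 j + A i 2 * B 2 j.
Proof.
rewrite mxE !big_ord_recl big_ord0 addr0 addrA.
by congr (_ * _ + _ * _ + _ * _); congr (_ _ _); apply: val_inj.
Qed.

Lemma cV3P u v : u = v <-> [/\ u 0 0 = v 0 0, u 1 0 = v 1 0 & u 2 0 = v 2 0].
Proof.
split=> [->//|[h0 h1 h2]]; apply/matrixP => i j; rewrite (ord1 j).
by have [->|->|->] := I3P i.
Qed.

Lemma M3P (A B : 'M[R]_3) : (forall u, A *m u = B *m u) -> A = B.
Proof.
move=> AB; apply/matrixP => i j.
have /matrixP/(_ i 0) := AB (delta_mx j 0).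
by rewrite -!colE !mxE.
Qed.

Lemma mx3E s i j : mx3 s i j = nth 0 (nth [::] s i) j :> R.
Proof. by rewrite mxE. Qed.

Lemma vec3_0 a b c : vec3 a b c 0 0 = a. Proof. by rewrite mxE. Qed.
Lemma vec3_1 a b c : vec3 a b c 1 0 = b. Proof. by rewrite mxE. Qed.
Lemma vec3_2 a b c : vec3 a b c 2 0 = c. Proof. by rewrite mxE. Qed.
Definition vec3s := (vec3_0, vec3_1, vec3_2).

Lemma det3E x : \det x =
  x 0 0 * (x 1 1 * x 2 2 - x 1 2 * x 2 1)
  - x 0 1 * (x 1 0 * x 2 2 - x 1 2 * x 2 0)
  + x 0 2 * (x 1 0 * x 2 1 - x 1 1 * x 2 0).
Proof.
rewrite (expand_det_row _ 0) !big_ord_recl big_ord0 /cofactor.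
rewrite !(expand_det_row _ 0) !big_ord_recl !big_ord0 /cofactor !det_mx11 !mxE.
pose f (a b : nat) := x (inord a) (inord b).
have E i j : x i j = f i j by rewrite /f !inord_val.
rewrite !E /= /bump /= !exprS !expr0; ring.
Qed.

Definition coordE := (vec3_0, vec3_1, vec3_2, mulmx3E, mxE).

(** The Lorentz cross product: it satisfies
[lorentz (cross u v) w = det (u, v, w)], see [lorentz_cross]. *)
Definition cross u v : 'cV[R]_3 :=
  vec3 (u 1 0 * v 2 0 - u 2 0 * v 1 0) (u 2 0 * v 0 0 - u 0 0 * v 2 0)
       (u 1 0 * v 0 0 - u 0 0 * v 1 0).

Definition Xi u : 'M[R]_3 :=
  mx3 [:: [:: 0; - u 2 0; u 1 0]; [:: u 2 0; 0; - u 0 0];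
          [:: u 1 0; - u 0 0; 0]].

(** The null vector spanning the line [ell]. *)
Definition nu : 'cV[R]_3 := e2 R - e3 R.

Lemma e1E : e1 R = vec3 1 0 0. Proof. by apply/cV3P; rewrite !mxE. Qed.
Lemma e2E : e2 R = vec3 0 1 0. Proof. by apply/cV3P; rewrite !mxE. Qed.
Lemma e3E : e3 R = vec3 0 0 1. Proof. by apply/cV3P; rewrite !mxE. Qed.
Lemma nuE : nu = vec3 0 1 (-1).
Proof. by apply/cV3P; rewrite /nu e2E e3E !mxE /=; split; ring. Qed.

Lemma mul_Xi u v : Xi u *m v = cross u v.
Proof. by apply/cV3P; rewrite !coordE /=; split; ring. Qed.

Lemma Xi_linear a u v : Xi (a *: u + v) = a *: Xi u + Xi v.
Proof.
apply/M3P => w; rewrite mulmxDl -scalemxAl !mul_Xi.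
by apply/cV3P; rewrite !coordE /=; split; ring.
Qed.

Lemma Xi_scale a u : Xi (a *: u) = a *: Xi u.
Proof.
by apply/M3P => w; rewrite -scalemxAl !mul_Xi; apply/cV3P; rewrite !coordE /=; split; ring.
Qed.

Lemma Xi_bracket u v : Xi u *m Xi v - Xi v *m Xi u = Xi (cross u v).
Proof.
apply/M3P => w; rewrite mulmxBl -!mulmxA !mul_Xi.
by apply/cV3P; rewrite !coordE /=; split; ring.
Qed.

Lemma YkE : Yk R = Xi (e3 R).
Proof.
by apply/M3P => w; rewrite mul_Xi e3E; apply/cV3P; rewrite !coordE /=; split; ring.
Qed.
Lemma YaE : Ya R = Xi (e1 R).
Proof.
by apply/M3P => w; rewrite mul_Xi e1E; apply/cV3P; rewrite !coordE /=; split; ring.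
Qed.
Lemma YnE : Yn R = Xi nu.
Proof.
by apply/M3P => w; rewrite mul_Xi nuE; apply/cV3P; rewrite !coordE /=; split; ring.
Qed.

Lemma skew_Xi (X : 'M[R]_3) :
  (forall u v, lorentz (X *m u) v + lorentz u (X *m v) = 0) ->
  exists y, X = Xi y.
Proof.
move=> skew; exists (vec3 (- X 1 2) (X 0 2) (X 1 0)).
have H a b c a' b' c' := skew (vec3 a b c) (vec3 a' b' c').
move: (H 1 0 0 1 0 0) (H 0 1 0 0 1 0) (H 0 0 1 0 0 1)
  (H 1 0 0 0 1 0) (H 1 0 0 0 0 1) (H 0 1 0 0 0 1).
rewrite /lorentz !coordE /= => h1 h2 h3 h4 h5 h6.
apply/matrixP => i j.
have [->|->|->] := I3P i; have [->|->|->] := I3P j; rewrite mx3E /= ?vec3s; lra.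
Qed.

Lemma lorentzBr u v w : lorentz u (v - w) = lorentz u v - lorentz u w.
Proof. by rewrite /lorentz !mxE; ring. Qed.

Lemma lorentzZl a u v : lorentz (a *: u) v = a * lorentz u v.
Proof. by rewrite /lorentz !mxE; ring. Qed.

Lemma lorentzZr a u v : lorentz u (a *: v) = a * lorentz u v.
Proof. by rewrite /lorentz !mxE; ring. Qed.

Lemma lorentz_nondeg u : (forall v, lorentz u v = 0) -> u = 0.
Proof.
move=> H; have := (H (e1 R), H (e2 R), H (e3 R)).
rewrite e1E e2E e3E /lorentz !vec3s => -[[h1 h2] h3].
by apply/cV3P; rewrite !mxE; split; lra.
Qed.

Definition columns u v w : 'M[R]_3 :=
  \matrix_(i, j) nth 0 [:: u i 0; v i 0; w i 0] j.

Lemma lorentz_cross u v w : lorentz (cross u v) w = \det (columns u v w).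
Proof. by rewrite det3E /lorentz !coordE /=; ring. Qed.

(** Together with [lorentz_cross] and the multiplicativity of the determinant, this
gives the equivariance of the cross product under O(2,1). *)
Lemma mul_columns x u v w :
  x *m columns u v w = columns (x *m u) (x *m v) (x *m w).
Proof.
have E a b c i j : columns a b c i j = nth 0 [:: a i 0; b i 0; c i 0] j.
  by rewrite mxE.
by apply/matrixP => i j; have [->|->|->] := I3P j; rewrite !(mulmx3E, E).
Qed.

Lemma O21_1 : O21 (1%:M : 'M[R]_3).
Proof. by move=> u v; rewrite !mul1mx. Qed.

Lemma O21M x y : O21 x -> O21 y -> O21 (x *m y).
Proof. by move=> Ox Oy u v; rewrite -!mulmxA Ox Oy. Qed.

Let J : 'M[R]_3 := mx3 [:: [:: 1; 0; 0]; [:: 0; 1; 0]; [:: 0; 0; -1]].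

Lemma lorentz_J u v : lorentz u v = (u^T *m J *m v) 0 0.
Proof. by rewrite /lorentz !coordE /=; ring. Qed.

Lemma detJ : \det J = -1.
Proof. by rewrite det3E !mxE /=; ring. Qed.


Lemma O21_det x : O21 x -> \det x ^+ 2 = 1.
Proof.
move=> Ox; have E : x^T *m J *m x = J.
  apply/matrixP => i j; have := Ox (delta_mx i 0) (delta_mx j 0).
  have P (A : 'M[R]_3) : A i j =
      ((delta_mx i 0 : 'cV_3)^T *m A *m (delta_mx j 0 : 'cV_3)) 0 0.
    by have [->|->|->] := I3P i; have [->|->|->] := I3P j; rewrite !coordE /=; ring.
  by rewrite !lorentz_J trmx_mul !mulmxA => h; rewrite [RHS]P [LHS]P !mulmxA.
by have := congr1 determinant E; rewrite !det_mulmx det_tr detJ => h; lra.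
Qed.

Lemma O21_unit x : O21 x -> x \in unitmx.
Proof.
move/O21_det => dx; rewrite unitmxE unitfE; apply/eqP => d0.
by move: dx; rewrite d0 expr2 mul0r => /esym/eqP; rewrite oner_eq0.
Qed.

Lemma O21V x : O21 x -> O21 (invmx x).
Proof. by move=> Ox u v; rewrite -Ox !mulmxA !mulmxV ?mul1mx ?O21_unit. Qed.

(** Both sides have the same Lorentz product with every [x *m w], since pairing a
cross product with a vector is a determinant. *)
Lemma O21_cross x u v : O21 x ->
  x *m cross u v = \det x *: cross (x *m u) (x *m v).
Proof.
move=> Ox; apply/subr0_eq/lorentz_nondeg => w.
have -> : w = x *m (invmx x *m w) by rewrite mulmxA mulmxV ?mul1mx ?O21_unit.
move: (invmx x *m w) => {}w.
have := lorentz_cross (x *m u) (x *m v) (x *m w).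
rewrite -mul_columns det_mulmx -lorentz_cross => E.
have := Ox (cross u v) w; have := O21_det Ox.
move: (\det x) (x *m cross u v) (cross _ _) E => d a b.
move: (cross u v) (x *m w) => c z E d2 Eaz.
have -> : lorentz (a - d *: b) z = lorentz a z - d * lorentz b z.
  by rewrite /lorentz !mxE; ring.
by rewrite Eaz E mulrA -expr2 d2 mul1r subrr.
Qed.

(** Up to sign, the adjoint action on so(2,1) is the standard action on L^3. *)
Lemma Xi_conj x u : O21 x -> x *m Xi u *m invmx x = \det x *: Xi (x *m u).
Proof.
move=> Ox; apply/M3P => v.
rewrite -scalemxAl -!mulmxA !mul_Xi O21_cross // mulmxA mulmxV ?mul1mx //.
exact: O21_unit.
Qed.

Definition rotation (c s : R) : 'M[R]_3 :=
  mx3 [:: [:: c; - s; 0]; [:: s; c; 0]; [:: 0; 0; 1]].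

(** The parameter is the eigenvalue on [nu]: the boost is diagonal with entries
[a^-1] and [a] in the null coordinates [p 1 0 + p 2 0] and [p 1 0 - p 2 0]. *)
Definition boost (a : R) : 'M[R]_3 :=
  mx3 [:: [:: 1; 0; 0]; [:: 0; (a + a^-1) / 2; (a^-1 - a) / 2];
          [:: 0; (a^-1 - a) / 2; (a + a^-1) / 2]].

(** The exponential of [t *: Yn], a quadratic polynomial because [Yn] is nilpotent. *)
Definition unip (t : R) : 'M[R]_3 :=
  mx3 [:: [:: 1; t; t]; [:: - t; 1 - t ^+ 2 / 2; - (t ^+ 2 / 2)];
          [:: t; t ^+ 2 / 2; 1 + t ^+ 2 / 2]].

Definition reflection (a b : R) : 'M[R]_3 :=
  mx3 [:: [:: a; 0; 0]; [:: 0; 1; 0]; [:: 0; 0; b]].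

Lemma O21_rotation c s : c ^+ 2 + s ^+ 2 = 1 -> O21 (rotation c s).
Proof.
move=> cs u v; rewrite /lorentz !coordE /=.
transitivity ((c ^+ 2 + s ^+ 2) * (u 0 0 * v 0 0 + u 1 0 * v 1 0) - u 2 0 * v 2 0).
  ring.
by rewrite cs; ring.
Qed.

Lemma O21_boost a : a != 0 -> O21 (boost a).
Proof. by move=> a0 u v; rewrite /lorentz !coordE /=; field. Qed.

Lemma O21_unip t : O21 (unip t).
Proof. by move=> u v; rewrite /lorentz !coordE /=; field. Qed.

Lemma O21_reflection a b : a ^+ 2 = 1 -> b ^+ 2 = 1 -> O21 (reflection a b).
Proof.
move=> ha hb u v; rewrite /lorentz !coordE /=.
transitivity (a ^+ 2 * (u 0 0 * v 0 0) + u 1 0 * v 1 0 - b ^+ 2 * (u 2 0 * v 2 0)).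
  ring.
by rewrite ha hb; ring.
Qed.

Lemma rotation_align u : exists c s r, [/\ c ^+ 2 + s ^+ 2 = 1, 0 <= r &
  rotation c s *m u = vec3 0 r (u 2 0)].
Proof.
set r := Num.sqrt (u 0 0 ^+ 2 + u 1 0 ^+ 2).
have r2 : r ^+ 2 = u 0 0 ^+ 2 + u 1 0 ^+ 2 by rewrite sqr_sqrtr // addr_ge0 // sqr_ge0.
have [r0|r0] := eqVneq r 0.
  exists 1, 0, 0; split=> //; first by ring.
  move: r2; rewrite r0 => r2; apply/cV3P; rewrite !coordE /=.
  have := sqr_ge0 (u 0 0); have := sqr_ge0 (u 1 0) => h1 h2.
  have /eqP : u 0 0 ^+ 2 = 0 by lra.
  have /eqP : u 1 0 ^+ 2 = 0 by lra.
  by rewrite !sqrf_eq0 => /eqP -> /eqP ->; split; ring.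
exists (u 1 0 / r), (u 0 0 / r), r; split; last 1 first.
- apply/cV3P; rewrite !coordE /=; split; last ring.
    by field.
  by transitivity ((u 0 0 ^+ 2 + u 1 0 ^+ 2) / r); [field|rewrite -r2; field].
- by rewrite !expr_div_n -mulrDl addrC -r2 divff // expf_neq0.
- exact: sqrtr_ge0.
Qed.

(** A boost by [a] multiplies [r + z] and [r - z] by [a^-1] and [a]; choosing [a] so
that their absolute values become equal kills one of the two coordinates. *)
Lemma boost_align r z : r ^+ 2 != z ^+ 2 -> exists2 a, 0 < a &
  exists c, boost a *m vec3 0 r z = vec3 0 c 0 \/ boost a *m vec3 0 r z = vec3 0 0 c.
Proof.
move=> rz; have s0 : r + z != 0 by apply: contra_neq rz; nra.
have d0 : r - z != 0 by apply: contra_neq rz; nra.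
set a := Num.sqrt `|(r + z) / (r - z)|.
have a0 : 0 < a by rewrite sqrtr_gt0 normr_gt0 mulf_neq0 ?invr_eq0.
have a2 : a ^+ 2 = `|(r + z) / (r - z)| by rewrite sqr_sqrtr.
exists a => //; have an0 : a != 0 by rewrite gt_eqF.
have [h|h] : a ^+ 2 * (r - z) = r + z \/ a ^+ 2 * (r - z) = - (r + z).
    rewrite a2; case: (ger0P ((r + z) / (r - z))) => _; [left|right]; by field.
- exists ((r + z) / a); left; apply/cV3P; rewrite !coordE /=; split; first ring.
    by transitivity ((r + z + a ^+ 2 * (r - z)) / (2 * a)); [|rewrite h]; field.
  by transitivity ((r + z - a ^+ 2 * (r - z)) / (2 * a)); [|rewrite h]; field.
- exists ((r + z) / a); right; apply/cV3P; rewrite !coordE /=; split; first ring.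
    by transitivity ((r + z + a ^+ 2 * (r - z)) / (2 * a)); [|rewrite h]; field.
  by transitivity ((r + z - a ^+ 2 * (r - z)) / (2 * a)); [|rewrite h]; field.
Qed.

(** Rotate [u] into the plane of [e2] and [e3]. Off the light cone, a boost moves it
to an axis; on the light cone, a reflection is enough. *)
Lemma O21_normal_form u : u != 0 -> exists2 x, O21 x &
  exists2 c, c != 0 & [\/ x *m u = c *: e3 R, x *m u = c *: e1 R | x *m u = c *: nu].
Proof.
move=> u0; suff [x Ox [c h]] : exists2 x, O21 x & exists c,
    [\/ x *m u = c *: e3 R, x *m u = c *: e1 R | x *m u = c *: nu].
  exists x => //; exists c => //; apply: contra_neq u0 => c0.
  have {}h : x *m u = 0 by case: h => ->; rewrite c0 scale0r.
  by rewrite -[u](mulKmx (O21_unit Ox)) h mulmx0.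
have [c [s [r [cs r0 E]]]] := rotation_align u; move: (u 2 0) E => z E.
have Or := O21_rotation cs.
have [rz|rz] := eqVneq (r ^+ 2) (z ^+ 2); last first.
  have [a a0 [k [ak|ak]]] := boost_align rz.
    exists (rotation 0 (-1) *m boost a *m rotation c s).
      apply: O21M => //; apply: O21M; last by apply: O21_boost; rewrite gt_eqF.
      by apply: O21_rotation; ring.
    exists k; apply: Or32; rewrite -!mulmxA E ak e1E.
    by apply/cV3P; rewrite !coordE /=; split; ring.
  exists (boost a *m rotation c s); first by apply: O21M => //; apply: O21_boost; rewrite gt_eqF.
  exists k; apply: Or31; rewrite -!mulmxA E ak e3E.
  by apply/cV3P; rewrite !coordE /=; split; ring.
move/eqP: rz; rewrite eqf_sqr => /orP[/eqP rz|/eqP rz].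
  exists (reflection 1 (-1) *m rotation c s); first by apply: O21M => //; apply: O21_reflection; ring.
  exists r; apply: Or33; rewrite -!mulmxA E nuE -rz.
  by apply/cV3P; rewrite !coordE /=; split; ring.
exists (rotation c s) => //; exists r; apply: Or33; rewrite E nuE rz.
by apply/cV3P; rewrite !coordE /=; split; ring.
Qed.

End Coordinates.

(** * One-parameter groups of isometries *)

Section OneParameter.
Variable R : realType.
Implicit Types (x : 'M[R]_3) (p u v w : 'cV[R]_3) (g X Y : aff R).
Implicit Types (gam : R -> aff R) (s t : R).

Lemma is_derive_mxP m n (M : R -> 'M[R]_(m.+1, n.+1)) t D :
  is_derive t (1 : R) M D <-> forall i j, is_derive t (1 : R) (fun s => M s i j) (D i j).
Proof.
split=> [[dM DM] i j|H].
  apply: DeriveDef; first exact: (derivable_mxP M t (1 : R)).1 dM i j.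
  by rewrite -DM derive_mx // mxE.
have dM : derivable M t (1 : R).
  by apply/derivable_mxP => i j; have [] := H i j.
apply: DeriveDef => //; rewrite derive_mx //.
by apply/matrixP => i j; rewrite mxE; have [_] := H i j.
Qed.

Lemma derive_add (f g : R -> R) t a b :
  is_derive t (1 : R) f a -> is_derive t (1 : R) g b ->
  is_derive t (1 : R) (fun s => f s + g s) (a + b).
Proof. by move=> df dg; exact: is_deriveD. Qed.

Lemma derive_mul (f g : R -> R) t a b :
  is_derive t (1 : R) f a -> is_derive t (1 : R) g b ->
  is_derive t (1 : R) (fun s => f s * g s) (a * g t + f t * b).
Proof.
move=> df dg; have := is_deriveM df dg; move/is_derive_eq; apply.
by rewrite /GRing.scale /= addrC; congr (_ + _); rewrite mulrC.
Qed.

Lemma derive_const (c t : R) : is_derive t (1 : R) (fun _ : R => c) 0.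
Proof. exact: is_derive_cst. Qed.

Lemma derive_mulmx m n (A : R -> 'M[R]_(m.+1, 3)) (B : R -> 'M[R]_(3, n.+1)) t dA dB :
  is_derive t (1 : R) A dA -> is_derive t (1 : R) B dB ->
  is_derive t (1 : R) (fun s => A s *m B s) (dA *m B t + A t *m dB).
Proof.
move=> /is_derive_mxP hA /is_derive_mxP hB; apply/is_derive_mxP => i j.
rewrite (_ : (fun s => _) = fun s => A s i 0 * B s 0 j + A s i 1 * B s 1 j
  + A s i 2 * B s 2 j); last by apply/funext => s; rewrite mulmx3E.
have E l := derive_mul (hA i l) (hB l j).
have := derive_add (derive_add (E 0) (E 1)) (E 2); move/is_derive_eq; apply.
by rewrite mxE !mulmx3E; ring.
Qed.


Lemma derive_shift_mx m n (M : R -> 'M[R]_(m.+1, n.+1)) D t :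
  is_derive (0 : R) (1 : R) M D -> is_derive t (1 : R) (fun s => M (s - t)) D.
Proof.
move=> /is_derive_mxP HM; apply/is_derive_mxP => i j.
have dM : is_derive (shift (- t) t) (1 : R) (fun s => M s i j) (D i j).
  by rewrite /= subrr.
have := is_derive1_comp dM (is_derive_shift t (1 : R) (- t)).
by rewrite mulr1.
Qed.

Lemma derive0_const m n (M : R -> 'M[R]_(m.+1, n.+1)) s t :
  (forall r, is_derive r (1 : R) M 0) -> M s = M t.
Proof.
move=> H; apply/matrixP => i j; apply: (@is_derive_0_is_cst _ (fun r => M r i j)).
by move=> r; have /is_derive_mxP/(_ i j) := H r; rewrite mxE.
Qed.

Lemma actM g1 g2 p : act (affM g1 g2) p = act g1 (act g2 p).
Proof. by rewrite /act /affM /= mulmxDr mulmxA addrA. Qed.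

Lemma act1 p : act (aff1 R) p = p.
Proof. by rewrite /act /aff1 /= mul1mx addr0. Qed.

Lemma affMA g1 g2 g3 : affM g1 (affM g2 g3) = affM (affM g1 g2) g3.
Proof. by rewrite /affM /= !mulmxA mulmxDr !mulmxA addrA. Qed.

Lemma aff1M g : affM (aff1 R) g = g.
Proof. by case: g => x u; rewrite /affM /= !mul1mx addr0. Qed.

Lemma affM1 g : affM g (aff1 R) = g.
Proof. by case: g => x u; rewrite /affM /= mulmx1 mulmx0 add0r. Qed.

Lemma affVM g : Isom R g -> affM (affV g) g = aff1 R.
Proof.
by case: g => x u Og; rewrite /affM /affV /= mulVmx ?subrr // O21_unit.
Qed.

Lemma affMV g : Isom R g -> affM g (affV g) = aff1 R.
Proof.
case: g => x u Og; rewrite /affM /affV /= mulmxV ?O21_unit //.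
by rewrite mulmxN mulmxA mulmxV ?O21_unit // mul1mx addNr.
Qed.

Lemma IsomM g1 g2 : Isom R g1 -> Isom R g2 -> Isom R (affM g1 g2).
Proof. exact: O21M. Qed.

Lemma IsomV g : Isom R g -> Isom R (affV g).
Proof. exact: O21V. Qed.

Lemma affVK g : Isom R g -> affV (affV g) = g.
Proof.
move=> Og; rewrite -[LHS]affM1 -(affVM Og) affMA affVM ?aff1M //.
exact: IsomV.
Qed.

Section Properties.
Variables (gam : R -> aff R) (X : aff R).
Hypothesis gamX : one_param gam X.

Lemma one_param0 : gam 0 = aff1 R.
Proof.
have [I0 M _ _] := gamX; have := M 0 0; rewrite addr0 => E.
by rewrite -[LHS]aff1M -{1}(affVM (I0 0)) -affMA -E affVM.
Qed.

(** The equation [gam' = gam X]: differentiate [gam s = gam t * gam (s - t)]. *)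
Lemma one_param_derivel t :
  is_derive t (1 : R) (fun s => (gam s).1) ((gam t).1 *m X.1) /\
  is_derive t (1 : R) (fun s => (gam s).2) ((gam t).1 *m X.2).
Proof.
have [_ M dX1 dX2] := gamX.
have E s : gam s = affM (gam t) (gam (s - t)) by rewrite -M addrC subrK.
have dc : is_derive t (1 : R) (fun _ : R => (gam t).1) 0 by exact: is_derive_cst.
have d1 := derive_mulmx dc (derive_shift_mx t dX1).
have d2 := derive_mulmx dc (derive_shift_mx t dX2).
split.
  rewrite (_ : (fun s => _) = fun s => (gam t).1 *m (gam (s - t)).1).
    by apply: is_derive_eq; rewrite mul0mx add0r.
  by apply/funext => s; rewrite {1}E.
rewrite (_ : (fun s => _) = fun s => (gam t).1 *m (gam (s - t)).2 + (gam t).2).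
  have dc2 : is_derive t (1 : R) (fun _ : R => (gam t).2) 0 by exact: is_derive_cst.
  by have := is_deriveD d2 dc2; rewrite mul0mx add0r addr0.
by apply/funext => s; rewrite {1}E.
Qed.

(** The other factorisation, [gam s = gam (s - t) * gam t], gives the velocity of an
orbit in terms of its current point. *)
Lemma derive_act t p :
  is_derive t (1 : R) (fun s => act (gam s) p) (X.1 *m act (gam t) p + X.2).
Proof.
have [_ M dX1 dX2] := gamX.
rewrite (_ : (fun s => _) = fun s => (gam (s - t)).1 *m act (gam t) p + (gam (s - t)).2).
  have dc : is_derive t (1 : R) (fun _ : R => act (gam t) p) 0 by exact: is_derive_cst.
  have := is_deriveD (derive_mulmx (derive_shift_mx t dX1) dc) (derive_shift_mx t dX2).
  by rewrite mulmx0 addr0.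
apply/funext => s; rewrite -[RHS]/(act (gam (s - t)) (act (gam t) p)) -actM -M.
by rewrite subrK.
Qed.

(** By [one_param_derivel] the curve [(gam s).1 *m w] has derivative [c] times
itself, so multiplying it by [expR (- c * s)] makes it constant. *)
Lemma one_param_eigen w c t :
  X.1 *m w = c *: w -> (gam t).1 *m w = expR (c * t) *: w.
Proof.
move=> Xw.
have dw s : is_derive s (1 : R) (fun s => (gam s).1 *m w) (c *: ((gam s).1 *m w)).
  have dc : is_derive s (1 : R) (fun _ : R => w) 0 by exact: is_derive_cst.
  have := derive_mulmx (one_param_derivel s).1 dc.
  by rewrite mulmx0 addr0 -mulmxA Xw -scalemxAr.
have de s : is_derive s (1 : R) (fun s => expR (- c * s)) (- c * expR (- c * s)).
  have dl : is_derive s (1 : R) (fun s => - c * s) (- c).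
    have := is_deriveZ (- c) (is_derive_id s (1 : R)).
    by rewrite /GRing.scale /= mulr1.
  by have := is_derive1_comp (is_derive_expR (- c * s)) dl; rewrite mulrC.
have E : expR (- c * t) *: ((gam t).1 *m w) = w.
  have E0 : expR (- c * 0) *: ((gam 0).1 *m w) = w.
    by rewrite mulr0 expR0 scale1r one_param0 mul1mx.
  rewrite -[RHS]E0.
  apply: (@derive0_const _ _ (fun s => expR (- c * s) *: ((gam s).1 *m w))) => s.
  apply/is_derive_mxP => i j.
  have := derive_mul (de s) ((is_derive_mxP _ _ _).1 (dw s) i j).
  have -> : (c *: ((gam s).1 *m w)) i j = c * ((gam s).1 *m w) i j by rewrite mxE.
  rewrite [X in is_derive _ _ _ X](_ : _ = 0); last by ring.
  rewrite mxE; congr is_derive; apply/funext => r; by rewrite [RHS]mxE.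
by rewrite -[in RHS]E scalerA -expRD mulNr subrr expR0 scale1r.
Qed.

Lemma one_param_fix w t : X.1 *m w = 0 -> (gam t).1 *m w = w.
Proof.
by move=> Xw; rewrite (@one_param_eigen w 0) ?mul0r ?expR0 ?scale1r ?scale0r.
Qed.

Lemma one_param_linear t : X.2 = 0 -> (gam t).2 = 0.
Proof.
move=> X2; transitivity (gam 0).2; last by rewrite one_param0.
apply: (@derive0_const _ _ (fun s => (gam s).2)) => s.
by have [_] := one_param_derivel s; rewrite X2 mulmx0.
Qed.

(** Differentiate the invariance of the Lorentz form at 0. *)
Lemma one_param_so21 : exists y, X.1 = Xi y.
Proof.
have [I M dX1 _] := gamX.
apply: skew_Xi => u v.
have d w : is_derive (0 : R) (1 : R) (fun s => (gam s).1 *m w) (X.1 *m w).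
  have dc : is_derive (0 : R) (1 : R) (fun _ : R => w) 0 by exact: is_derive_cst.
  by have := derive_mulmx dX1 dc; rewrite mulmx0 addr0.
have D w i := (is_derive_mxP _ _ _).1 (d w) i 0.
have := is_deriveB (derive_add (derive_mul (D u 0) (D v 0)) (derive_mul (D u 1) (D v 1)))
  (derive_mul (D u 2) (D v 2)).
set F := (_ - _) => dF.
have F0 : F = cst (lorentz u v) by apply/funext => s; exact: I.
have [_ E] := dF; have := derive_cst (lorentz u v) (0 : R) (1 : R).
rewrite -F0 E one_param0 !mul1mx => <-.
by rewrite /lorentz; ring.
Qed.

(** The sign ambiguity of [O21_det] disappears because [gam t] is a square. *)
Lemma one_param_det t : \det (gam t).1 = 1.
Proof.
have [I M _ _] := gamX; rewrite (splitr t) M det_mulmx -expr2.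
exact: O21_det (I _).
Qed.

Lemma one_param_lorentz n p t :
  (forall q, lorentz n (X.1 *m q + X.2) = 0) ->
  lorentz n (act (gam t) p) = lorentz n p.
Proof.
move=> H; rewrite -{2}(act1 p) -one_param0.
apply: (@is_derive_0_is_cst _ (fun s => lorentz n (act (gam s) p))) => s.
have D i := (is_derive_mxP _ _ _).1 (derive_act s p) i 0.
have := is_deriveB (derive_add (derive_mul (derive_const (n 0 0) s) (D 0))
  (derive_mul (derive_const (n 1 0) s) (D 1)))
  (derive_mul (derive_const (n 2 0) s) (D 2)).
move/is_derive_eq; apply; rewrite -[RHS](H (act (gam s) p)).
by rewrite /lorentz !mul0r !add0r.
Qed.

End Properties.
End OneParameter.

(** * Explicit one-parameter groups, and conjugation *)

Section Exponentials.
Variable R : realType.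
Implicit Types (x : 'M[R]_3) (p u v w : 'cV[R]_3) (g h X Y : aff R).
Implicit Types (gam : R -> aff R) (s t : R).
Implicit Types (H S : set (aff R)).

Definition conj g h := affM (affM g h) (affV g).
Definition Ad g X : aff R :=
  (g.1 *m X.1 *m invmx g.1, g.1 *m X.2 - g.1 *m X.1 *m invmx g.1 *m g.2).

Lemma conjM g h1 h2 : Isom R g -> conj g (affM h1 h2) = affM (conj g h1) (conj g h2).
Proof.
by move=> Ig; rewrite /conj -!affMA [affM (affV g) (affM g _)]affMA affVM // aff1M.
Qed.

Lemma conjK g h : Isom R g -> conj (affV g) (conj g h) = h.
Proof.
by move=> Ig; rewrite /conj affVK // -!affMA affVM // affM1 affMA affVM // aff1M.
Qed.

Lemma conjVK g h : Isom R g -> conj g (conj (affV g) h) = h.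
Proof. by move=> Ig; have := conjK h (IsomV Ig); rewrite affVK. Qed.

Lemma act_conj g h p : Isom R g -> act (conj g h) (act g p) = act g (act h p).
Proof. by move=> Ig; rewrite !actM -(actM (affV g) g) affVM // act1. Qed.

Lemma AdK g X : Isom R g -> Ad (affV g) (Ad g X) = X.
Proof.
case: g X => x u [A v] Ox; rewrite /Ad /affV /=.
have xV := O21_unit Ox.
rewrite invmxK !mulmxA mulVmx // mul1mx mulmxBr !mulmxA mulVmx // !mul1mx.
rewrite -!mulmxA mulVmx // mulmx1; congr pair.
by rewrite !mulmxN !mulmxA -[_ *m invmx x *m x]mulmxA mulVmx // mulmx1 opprK subrK.
Qed.

Lemma one_param_conj g gam X : Isom R g -> one_param gam X ->
  one_param (fun t => conj g (gam t)) (Ad g X).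
Proof.
move=> Ig [I M d1 d2]; have dc m n (B : 'M[R]_(m.+1, n.+1)) :
    is_derive (0 : R) (1 : R) (fun _ : R => B) 0 by exact: is_derive_cst.
have d1' := derive_mulmx (derive_mulmx (dc _ _ g.1) d1) (dc _ _ (invmx g.1)).
split=> [t|s t||].
- by apply: IsomM; [exact: IsomM|exact: IsomV].
- by rewrite M conjM.
- by move: d1'; rewrite mul0mx add0r mulmx0 addr0.
- have := is_deriveD (is_deriveB (derive_mulmx (dc _ _ g.1) d2)
    (derive_mulmx d1' (dc _ _ g.2))) (dc _ _ g.2).
  rewrite !mul0mx !add0r !mulmx0 !addr0.
  congr is_derive; apply/funext => t.
  by rewrite /conj /affM /affV /= mulmxN !mulmxA [RHS]addrC [RHS]addrAC.
Qed.

Lemma one_param_scale gam X a : one_param gam X ->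
  one_param (fun t => gam (a * t)) (a *: X).
Proof.
move=> gamX; have [I M _ _] := gamX.
have dl : is_derive (0 : R) (1 : R) (fun s : R => a * s) a.
  have := is_deriveZ a (is_derive_id (0 : R) (1 : R)).
  by rewrite /GRing.scale /= mulr1.
have [d1 d2] := one_param_derivel gamX (a * 0).
have d n (F : R -> 'M[R]_(3, n.+1)) D : is_derive (a * 0) (1 : R) F D ->
  is_derive (0 : R) (1 : R) (fun t => F (a * t)) (a *: D).
  move=> /is_derive_mxP dF; apply/is_derive_mxP => i j; rewrite mxE mulrC.
  exact: (is_derive1_comp (dF i j) dl).
split=> [//|s t||]; first by rewrite mulrDr M.
- by have := d _ _ _ d1; rewrite mulr0 (one_param0 gamX) mul1mx.
- by have := d _ _ _ d2; rewrite mulr0 (one_param0 gamX) mul1mx.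
Qed.

Lemma one_param_trans v : one_param (fun t => (1%:M, t *: v)) (0, v).
Proof.
split=> [t|s t||] /=.
- exact: O21_1.
- by rewrite /affM /= !mul1mx scalerDl addrC.
- exact: is_derive_cst.
- apply/is_derive_mxP => i j.
  have := derive_mul (is_derive_id (0 : R) (1 : R)) (derive_const (v i j) 0).
  rewrite mul1r mulr0 addr0.
  by congr is_derive; apply/funext => r; rewrite /= !mxE.
Qed.

Lemma one_param_lin (x : R -> 'M[R]_3) (X : 'M[R]_3) : (forall t, O21 (x t)) ->
  (forall s t, x (s + t) = x s *m x t) -> is_derive (0 : R) (1 : R) x X ->
  one_param (fun t => (x t, 0 : 'cV[R]_3)) (X, 0).
Proof.
move=> Ox xM dx; split=> // [s t|]; last exact: is_derive_cst.
by rewrite /affM /= xM mulmx0 addr0.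
Qed.

Lemma derive_mx3 (l : R -> seq (seq R)) (X : 'M[R]_3) :
  (forall i j : 'I_3,
    is_derive (0 : R) (1 : R) (fun t => nth 0 (nth [::] (l t) i) j) (X i j)) ->
  is_derive (0 : R) (1 : R) (fun t => mx3 (l t)) X.
Proof.
move=> H; apply/is_derive_mxP => i j; have := H i j.
by congr is_derive; apply/funext => t; rewrite mxE.
Qed.

Lemma one_param_rotation : one_param (fun t => (rotation (cos t) (sin t), 0)) (Yk R, 0).
Proof.
apply: one_param_lin => [t|s t|].
- by apply: O21_rotation; rewrite cos2Dsin2.
- apply/M3P => u; rewrite -mulmxA cosD sinD.
  by apply/cV3P; rewrite !coordE /=; split; ring.
- have dc : is_derive (0 : R) (1 : R) (@cos R) 0.
    by have := is_derive_cos (0 : R); rewrite sin0 oppr0.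
  have ds : is_derive (0 : R) (1 : R) (@sin R) 1.
    by have := is_derive_sin (0 : R); rewrite cos0.
  apply: derive_mx3 => i j; rewrite mxE.
  have [->|->|->] := I3P i; have [->|->|->] := I3P j => //=; try exact: derive_const.
  exact: is_deriveN.
Qed.

Lemma one_param_boost : one_param (fun t => (boost (expR t), 0)) (Ya R, 0).
Proof.
apply: one_param_lin => [t|s t|].
- by apply: O21_boost; rewrite gt_eqF // expR_gt0.
- apply/M3P => u; rewrite -mulmxA expRD.
  have := expR_gt0 s; have := expR_gt0 t; move: (expR s) (expR t) => a b.
  move=> /lt0r_neq0 bn /lt0r_neq0 an.
  apply/cV3P; rewrite !coordE /=; by split; field; rewrite ?an ?bn.
- have de : is_derive (0 : R) (1 : R) (@expR R) 1.
    by have := is_derive_expR (0 : R); rewrite expR0.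
  have dn : is_derive (0 : R) (1 : R) (fun t : R => (expR t)^-1) (-1).
    have e0 : expR (0 : R) != 0 by rewrite expR0 oner_eq0.
    have := is_deriveV e0 de.
    by rewrite expR0 expr1n invr1 /GRing.scale /= mulr1.
  have dN := is_deriveN de.
  have dp := derive_mul (derive_add de dn) (derive_const (2^-1 : R) 0).
  have dm := derive_mul (is_deriveB dn de) (derive_const (2^-1 : R) 0).
  apply: derive_mx3 => i j; rewrite mxE.
  have [->|->|->] := I3P i; have [->|->|->] := I3P j => //=; try exact: derive_const.
  + by move/is_derive_eq : dp; apply; ring.
  + by move/is_derive_eq : dm; apply; rewrite mulr0 addr0; field.
  + by move/is_derive_eq : dm; apply; rewrite mulr0 addr0; field.
  + by move/is_derive_eq : dp; apply; ring.
Qed.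

Lemma one_param_unip : one_param (fun t => (unip t, 0)) (Yn R, 0).
Proof.
apply: one_param_lin => [t|s t|].
- exact: O21_unip.
- apply/M3P => u; rewrite -mulmxA.
  by apply/cV3P; rewrite !coordE /=; split; field.
- have di : is_derive (0 : R) (1 : R) (fun t : R => t) 1 by exact: is_derive_id.
  have dq : is_derive (0 : R) (1 : R) (fun t : R => t ^+ 2 / 2) 0.
    have := derive_mul (derive_mul di di) (derive_const (2^-1 : R) 0).
    by rewrite !mulr0 !mul0r !addr0 mul0r.
  have d1 := derive_const (1 : R) 0.
  apply: derive_mx3 => i j; rewrite mxE.
  have [->|->|->] := I3P i; have [->|->|->] := I3P j => //=; try exact: derive_const.
  + exact: is_deriveN.
  + by have := is_deriveB d1 dq; rewrite subr0.
  + by have := is_deriveN dq; rewrite oppr0.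
  + by have := derive_add d1 dq; rewrite addr0.
Qed.

Lemma circle_cos_sin (c s : R) : c ^+ 2 + s ^+ 2 = 1 ->
  exists t, c = cos t /\ s = sin t.
Proof.
move=> cs; have c1 : -1 <= c <= 1 by apply/andP; nra.
have s2 : Num.sqrt (1 - c ^+ 2) = `|s| by rewrite -cs addrAC subrr add0r sqrtr_sqr.
have [s0|s0] := leP 0 s.
  by exists (acos c); rewrite sin_acos // acosK // s2 ger0_norm.
exists (- acos c); rewrite cosN sinN sin_acos // acosK // s2.
by rewrite ltr0_norm // opprK.
Qed.

End Exponentials.

(** * Generated subgroups and transport of the hypotheses by conjugation *)

Section LieGroups.
Variable R : realType.
Implicit Types (x : 'M[R]_3) (p q u v w : 'cV[R]_3) (g h X Y : aff R).
Implicit Types (gam : R -> aff R) (s t a b : R).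
Implicit Types (H G K S : set (aff R)).

Lemma subgroup_Isom : subgroup (Isom R).
Proof.
split=> //; first exact: O21_1.
- exact: IsomM.
- exact: IsomV.
Qed.

Lemma generated_min G K : subgroup K -> G `<=` K -> generated G `<=` K.
Proof. exact: smallest_sub. Qed.

Lemma sub_generated G : G `<=` generated G.
Proof. exact: sub_smallest. Qed.

Lemma subgroup_generated G : G `<=` Isom R -> subgroup (generated G).
Proof.
move=> GI; split.
- exact: (generated_min subgroup_Isom).
- by move=> K [[]].
- by move=> g1 g2 G1 G2 K sK; have [[_ _ KM _] _] := sK; apply: KM; [exact: G1|exact: G2].
- by move=> g1 G1 K sK; have [[_ _ _ KV] _] := sK; apply: KV; exact: G1.
Qed.

(** The exponentials of an arbitrary set, so that the transport by [Ad] can be done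
without building subspaces of the Lie algebra. *)
Definition Exp_set S : set (aff R) :=
  [set g | exists gam X, [/\ S X, one_param gam X & g = gam 1]].

Lemma Exp_set_Isom S : Exp_set S `<=` Isom R.
Proof. by move=> _ [gam [X [_ [I _ _ _] ->]]]. Qed.

Lemma Exp_set_mono S1 S2 : S1 `<=` S2 -> Exp_set S1 `<=` Exp_set S2.
Proof. by move=> S12 g [gam [X [SX gX ->]]]; exists gam, X; split=> //; exact: S12. Qed.

(** The conjugates of [H] and [S], written as preimages under the inverse
conjugation. *)
Definition conj_set g H : set (aff R) := [set h | H (conj (affV g) h)].
Definition Ad_set g S : set (aff R) := [set X | S (Ad (affV g) X)].

Lemma conj_setK g H : Isom R g -> conj_set (affV g) (conj_set g H) = H.
Proof.
by move=> Ig; apply/seteqP; split=> h; rewrite /conj_set /= affVK // conjK.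
Qed.

Lemma conj_set_mem g H h : Isom R g -> H h -> conj_set g H (conj g h).
Proof. by move=> Ig Hh; rewrite /conj_set /= conjK. Qed.

Lemma Ad_set_mem g S X : Isom R g -> S X -> Ad_set g S (Ad g X).
Proof. by move=> Ig SX; rewrite /Ad_set /= AdK. Qed.

Lemma Isom_conj g h : Isom R g -> Isom R h -> Isom R (conj g h).
Proof. by move=> Ig Ih; apply: IsomM; [exact: IsomM|exact: IsomV]. Qed.

Lemma Isom_conj_set g H : Isom R g -> H `<=` Isom R -> conj_set g H `<=` Isom R.
Proof.
move=> Ig HI h /HI Ih; rewrite -(conjVK h Ig); exact: Isom_conj.
Qed.

Lemma affV_uniq g h : Isom R g -> affM h g = aff1 R -> h = affV g.
Proof. by move=> Ig hg; rewrite -[h]affM1 -(affMV Ig) affMA hg aff1M. Qed.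

Lemma conjV g h : Isom R g -> Isom R h -> conj g (affV h) = affV (conj g h).
Proof.
move=> Ig Ih; apply: affV_uniq; first exact: Isom_conj.
by rewrite -conjM // affVM // /conj affM1 affMV.
Qed.

Lemma subgroup_conj g H : Isom R g -> subgroup H -> subgroup (conj_set g H).
Proof.
move=> Ig [HI H1 HM HV]; have IV := IsomV Ig; split.
- exact: Isom_conj_set.
- by rewrite /conj_set /= /conj affM1 affVK // affVM.
- by move=> h1 h2 H1' H2'; rewrite /conj_set /= conjM //; exact: HM.
- move=> h Hh; rewrite /conj_set /= conjV //; first exact: HV.
  exact: (Isom_conj_set Ig HI).
Qed.

Lemma conj_set_mono g H K : H `<=` K -> conj_set g H `<=` conj_set g K.
Proof. by move=> HK h; exact: HK. Qed.

Lemma generated_conj g G : Isom R g -> G `<=` Isom R ->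
  conj_set g (generated G) = generated (conj_set g G).
Proof.
move=> Ig GI; have IV := IsomV Ig; apply/seteqP; split.
  suff sub : generated G `<=` conj_set (affV g) (generated (conj_set g G)).
    by move=> h /sub; rewrite /conj_set /= affVK // conjVK.
  apply: generated_min.
    by apply: subgroup_conj => //; apply: subgroup_generated; exact: Isom_conj_set.
  rewrite -{1}(conj_setK G Ig); apply: conj_set_mono; exact: sub_generated.
apply: generated_min; first by apply: subgroup_conj => //; exact: subgroup_generated.
by apply: conj_set_mono; exact: sub_generated.
Qed.

Lemma Ad_linear g a X Y : Ad g (a *: X + Y) = a *: Ad g X + Ad g Y.
Proof.
rewrite /Ad /=; congr pair.
  by rewrite mulmxDr mulmxDl -scalemxAr -scalemxAl.
rewrite !mulmxDr !mulmxDl -!scalemxAr -!scalemxAl.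
by rewrite -[(a *: (_, _)).2]/(a *: (_ - _)) scalerBr opprD addrACA.
Qed.

Lemma Ad_bracket g X Y : Isom R g -> Ad g (bracket X Y) = bracket (Ad g X) (Ad g Y).
Proof.
case: g X Y => x u [A a] [B b] Ox; have xV := O21_unit Ox; rewrite /Ad /bracket /=.
have K m (C : 'M[R]_(m, 3)) : C *m invmx x *m x = C.
  by rewrite -mulmxA mulVmx // mulmx1.
rewrite !(mulmxBr, mulmxBl) !mulmxA !K; congr pair.
by rewrite !opprB addrACA [in RHS]addrACA; congr (_ + _); exact: addrC.
Qed.

(** The content of being a connected Lie subgroup, with the Lie algebra as a plain
set [S]; in this form it is stable under conjugation ([lie_group_conj]). *)
Record lie_group H S : Prop := LieGroup {
  lie_subgroup : subgroup H;
  lie_alg : lie_algebra H = S;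
  lie_gen : H = generated (Exp_set S);
  lie_0 : S 0;
  lie_lin : forall a X Y, S X -> S Y -> S (a *: X + Y);
  lie_bracket : forall X Y, S X -> S Y -> S (bracket X Y) }.

(** The value at [p] of the fundamental vector field of [X]. *)
Definition velocity X p : 'cV[R]_3 := X.1 *m p + X.2.

(** Cohomogeneity one in terms of velocity spaces: none of them is L^3, and one of
them is a plane. *)
Record cohom1 S : Prop := Cohom1 {
  no_open_orbit : forall p, exists q, forall X, S X -> velocity X p <> q;
  plane_orbit : exists p u v, cross u v != 0 /\
    forall q, (exists2 X, S X & velocity X p = q) <-> (exists a b, q = a *: u + b *: v) }.

Lemma velocity_Ad g X p : Isom R g -> velocity (Ad g X) (act g p) = g.1 *m velocity X p.
Proof.
case: g X => x u [A a] Ox; have xV := O21_unit Ox; rewrite /velocity /Ad /act /=.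
have K m (C : 'M[R]_(m, 3)) : C *m invmx x *m x = C.
  by rewrite -mulmxA mulVmx // mulmx1.
by rewrite !mulmxDr !mulmxA !K addrACA subrr addr0.
Qed.

Lemma one_param_Ad g gam X : Isom R g -> one_param gam X ->
  one_param (fun t => conj (affV g) (gam t)) (Ad (affV g) X).
Proof. by move=> Ig; apply: one_param_conj; exact: IsomV. Qed.

Lemma AdVK g X : Isom R g -> Ad g (Ad (affV g) X) = X.
Proof. by move=> Ig; have := AdK X (IsomV Ig); rewrite affVK. Qed.

Lemma Exp_set_conj g S : Isom R g -> Exp_set (Ad_set g S) = conj_set g (Exp_set S).
Proof.
move=> Ig; apply/seteqP; split=> h.
  move=> [gam [X [SX gX ->]]]; exists (fun t => conj (affV g) (gam t)), (Ad (affV g) X).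
  by split; [exact: SX|exact: one_param_Ad|].
move=> [gam [X [SX gX E]]]; exists (fun t => conj g (gam t)), (Ad g X).
split; first exact: Ad_set_mem.
  exact: one_param_conj.
by rewrite -E conjVK.
Qed.

Lemma lie_group_conj g H S : Isom R g -> lie_group H S ->
  lie_group (conj_set g H) (Ad_set g S).
Proof.
move=> Ig [sH aH gH S0 Sl Sb]; have IV := IsomV Ig; split.
- exact: subgroup_conj.
- rewrite -aH; apply/seteqP; split=> X.
    move=> [gam gX Hg]; exists (fun t => conj (affV g) (gam t)); last exact: Hg.
    exact: one_param_Ad.
  move=> [gam gX Hg]; exists (fun t => conj g (gam t)).
    by rewrite -(AdVK X Ig); exact: one_param_conj.
  by move=> t; exact: conj_set_mem.
- by rewrite gH generated_conj ?Exp_set_conj //; exact: Exp_set_Isom.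
- rewrite /Ad_set /= (_ : Ad (affV g) 0 = 0) //.
  by rewrite /Ad /= !mulmx0 !mul0mx subr0.
- by move=> a X Y SX SY; rewrite /Ad_set /= Ad_linear; exact: Sl.
- by move=> X Y SX SY; rewrite /Ad_set /= Ad_bracket //; exact: Sb.
Qed.

Lemma cohom1_conj g S : Isom R g -> cohom1 S -> cohom1 (Ad_set g S).
Proof.
move=> Ig [no [p [u [v [uv E]]]]]; have IV := IsomV Ig.
have gu := O21_unit Ig.
split=> [p'|].
  have [q Hq] := no (act (affV g) p'); exists (g.1 *m q) => X SX.
  move=> E'; apply: (Hq _ SX); rewrite velocity_Ad // E'.
  by rewrite mulmxA mulVmx // mul1mx.
exists (act g p), (g.1 *m u), (g.1 *m v); split.
  apply: contra_neq uv => uv0.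
  have := O21_cross u v Ig; rewrite uv0 scaler0 => /(congr1 (mulmx (invmx g.1))).
  by rewrite mulmx0 mulmxA mulVmx // mul1mx.
move=> q; split=> [[X SX <-]|[a [b ->]]].
  have [|a [b Eab]] := (E (velocity (Ad (affV g) X) p)).1; first by exists (Ad (affV g) X).
  exists a, b; rewrite -{1}(AdVK X Ig) velocity_Ad // Eab.
  by rewrite mulmxDr -!scalemxAr.
have [|X SX EX] := (E (a *: u + b *: v)).2; first by exists a, b.
exists (Ad g X); first exact: Ad_set_mem.
by rewrite velocity_Ad // EX mulmxDr -!scalemxAr.
Qed.

Lemma orbit_equivalent_conj g H G : Isom R g ->
  orbit_equivalent (conj_set g H) G -> orbit_equivalent H G.
Proof.
move=> Ig [k Ik kE]; exists (affM k g); first exact: IsomM.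
rewrite -kE.
have E p : act g @` Defs.orbit H p = Defs.orbit (conj_set g H) (act g p).
  apply/seteqP; split=> q.
    move=> [_ [h Hh <-] <-]; exists (conj g h); first exact: conj_set_mem.
    by rewrite act_conj.
  move=> [h Hh <-]; exists (act (conj (affV g) h) p); first by exists (conj (affV g) h).
  by rewrite -act_conj // conjVK.
have E2 (O : set 'cV[R]_3) : act (affM k g) @` O = act k @` (act g @` O).
  by rewrite image_comp; congr (_ @` _); apply/funext => p; rewrite actM.
apply/seteqP; split=> O.
  move=> [_ [p _ <-] <-]; rewrite E2 E; exists (Defs.orbit (conj_set g H) (act g p)) => //.
  by exists (act g p).
move=> [_ [p _ <-] <-]; exists (Defs.orbit H (act (affV g) p)); first by exists (act (affV g) p).
by rewrite E2 E -actM affMV // act1.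
Qed.

End LieGroups.

(** * Groups with planar orbits, and products with a line *)

Section Groups.
Variable R : realType.
Implicit Types (x y : 'M[R]_3) (p q u v w : 'cV[R]_3) (g h X Y : aff R).
Implicit Types (gam : R -> aff R) (s t a b : R).
Implicit Types (H G K S : set (aff R)).

Lemma generated_Exp gam X S a : one_param gam X -> S (a *: X) ->
  generated (Exp_set S) (gam a).
Proof.
move=> gX SX; apply: sub_generated; exists (fun t => gam (a * t)), (a *: X).
split; [exact: SX|exact: one_param_scale|by rewrite mulr1].
Qed.

Lemma lie_exp H S gam X a : lie_group H S -> one_param gam X -> S (a *: X) ->
  H (gam a).
Proof. by move=> HS gX SX; rewrite (lie_gen HS); exact: generated_Exp gX SX. Qed.

(** How a connected group is bounded from above: it is enough to check its
one-parameter subgroups. *)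
Lemma lie_group_sub H S K : lie_group H S -> subgroup K ->
  (forall gam X t, one_param gam X -> S X -> K (gam t)) -> H `<=` K.
Proof.
move=> HS sK HK; rewrite (lie_gen HS); apply: generated_min => // _ [gam [X [SX gX ->]]].
exact: HK gX SX.
Qed.

Lemma orbit_translations (V : {vspace 'cV[R]_3}) p q :
  Defs.orbit (translations V) p q <-> q - p \in V.
Proof.
split=> [[_ [v /= Vv <-] <-]|Vqp].
  by rewrite /act /= mul1mx addrC addKr.
exists (1%:M, q - p); first by exists (q - p).
by rewrite /act /= mul1mx addrC subrK.
Qed.

(** The form [lorentz n] is constant along orbits because velocities lie in [V], so
orbits stay in translates of [V]; the translations in [H] fill these up. *)
Lemma orbits_plane H S n (V : {vspace 'cV[R]_3}) : lie_group H S ->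
  (forall v, (v \in V) = (lorentz n v == 0)) ->
  (forall X q, S X -> velocity X q \in V) ->
  (forall v, v \in V -> S (0, v)) ->
  orbits H = orbits (translations V).
Proof.
move=> HS VE SV VS; suff E : Defs.orbit H = Defs.orbit (translations V).
  by rewrite /orbits E.
apply/funext => p; apply/seteqP; split=> q.
  move=> [h Hh <-]; apply/orbit_translations; rewrite VE lorentzBr subr_eq0.
  pose K : set (aff R) :=
    [set g | Isom R g /\ forall p, lorentz n (act g p) = lorentz n p].
  have sK : subgroup K.
    split=> [g []//||g1 g2 [I1 K1] [I2 K2]|g [Ig Kg]].
    - by split=> [|r]; [exact: O21_1|rewrite act1].
    - by split=> [|r]; [exact: IsomM|rewrite actM K1 K2].
    - split=> [|r]; first exact: IsomV.
      by rewrite -Kg -actM affMV // act1.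
  suff [_ /(_ p) ->] : K h by [].
  apply: (lie_group_sub HS sK) Hh => gam X t gX SX; split=> [|r].
    by have [] := gX.
  apply: (one_param_lorentz gX) => r'; apply/eqP; rewrite -VE; exact: SV.
move/orbit_translations => Vqp.
exists (1%:M, 1 *: (q - p)); last by rewrite scale1r /act /= mul1mx addrC subrK.
apply: (lie_exp HS (one_param_trans (q - p))).
by rewrite scale1r; exact: VS.
Qed.

Lemma connected_subgroupE (h : {vspace aff R}) :
  connected_subgroup h = generated (Exp_set [set` h]).
Proof. by []. Qed.

(** Since [Y] kills [w], a one-parameter group generated by [(a *: Y, b *: w)] fixes
[w], hence it splits off the translations along [w] as a commuting factor. *)
Lemma generated_line_product H S (Y : 'M[R]_3) w : lie_group H S ->
  (forall X, S X <-> exists a b, X = (a *: Y, b *: w)) -> Y *m w = 0 ->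
  H = generated (connected_subgroup <[(Y, 0) : aff R]> `|` translations <[w]>).
Proof.
move=> HS SE Yw; have [HI H1 HM HV] := lie_subgroup HS.
have grpI : connected_subgroup <[(Y, 0) : aff R]>
    `|` translations <[w]> `<=` Isom R.
  move=> h [|[v _ <-]]; last exact: O21_1.
  rewrite connected_subgroupE; apply: (generated_min (@subgroup_Isom R)).
  exact: Exp_set_Isom.
apply/seteqP; split.
  apply: (lie_group_sub HS (subgroup_generated grpI)) => gam X t gX.
  move=> /SE [a [b EX]].
  have fixw s : (gam s).1 *m w = w.
    by apply: (one_param_fix gX); rewrite EX /= -scalemxAl Yw scaler0.
  pose gam0 s : aff R := ((gam s).1, (gam s).2 - (s * b) *: w).
  have g0X : one_param gam0 (a *: Y, 0).
    have [I M d1 d2] := gX; split=> [s|s s'||].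
    - exact: I.
    - rewrite /gam0 M /affM /=; congr pair.
      rewrite mulmxBr -scalemxAr fixw mulrDl scalerDl.
      by rewrite [_ *: w + _]addrC opprD addrACA.
    - by move: d1; rewrite EX.
    - apply/is_derive_mxP => i j.
      have := is_deriveB ((is_derive_mxP _ _ _).1 d2 i j)
        (derive_mul (is_derive_id (0 : R) (1 : R)) (derive_const ((b *: w) i j) 0)).
      rewrite EX /= mul1r mulr0 addr0 subrr.
      have -> : (0 : 'cV[R]_3) i j = 0 by rewrite mxE.
      by congr is_derive; apply/funext => r; rewrite /= -scalerA !mxE.
  have -> : gam t = affM (1%:M, (t * b) *: w) (gam0 t).
    by rewrite /affM /= !mul1mx subrK -surjective_pairing.
  have [_ _ GM _] := subgroup_generated grpI; apply: GM; apply: sub_generated.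
    by right; exists ((t * b) *: w) => //=; exact: memvZ (memv_line w).
  left; rewrite connected_subgroupE; apply: (generated_Exp g0X) => /=.
  apply/vlineP; exists (t * a); congr pair => /=; first by rewrite scalerA.
  by rewrite !scaler0.
apply: generated_min; first exact: lie_subgroup HS.
move=> h [|[v /vlineP[c ->] <-]].
  rewrite (lie_gen HS) connected_subgroupE; apply: generated_min.
    by apply: subgroup_generated; exact: Exp_set_Isom.
  move=> g Hg; apply: sub_generated; apply: Exp_set_mono Hg => X /vlineP[c ->].
  by apply/SE; exists c, 0; congr pair; rewrite /= ?scale0r ?scaler0.
have := lie_exp HS (one_param_trans w) (a := c); apply.
by apply/SE; exists 0, c; congr pair; rewrite /= ?scale0r ?scaler0.
Qed.

End Groups.

(** * The groups AN and SO(2,1) *)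

Section AN_SO.
Variable R : realType.
Implicit Types (x y : 'M[R]_3) (p q u v w : 'cV[R]_3) (g h X Y : aff R).
Implicit Types (gam : R -> aff R) (s t a b : R).
Implicit Types (H G K S : set (aff R)).

Lemma O21_entries x i j : O21 x ->
  x 0 i * x 0 j + x 1 i * x 1 j - x 2 i * x 2 j =
  lorentz (delta_mx i 0) (delta_mx j 0).
Proof. by move=> Ox; rewrite -Ox -!colE /lorentz !mxE. Qed.

Lemma O21_gram x : O21 x ->
  [/\ x 0 0 * x 0 0 + x 1 0 * x 1 0 - x 2 0 * x 2 0 = 1,
      x 0 1 * x 0 1 + x 1 1 * x 1 1 - x 2 1 * x 2 1 = 1 &
      x 0 2 * x 0 2 + x 1 2 * x 1 2 - x 2 2 * x 2 2 = -1] /\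
  [/\ x 0 0 * x 0 1 + x 1 0 * x 1 1 - x 2 0 * x 2 1 = 0,
      x 0 0 * x 0 2 + x 1 0 * x 1 2 - x 2 0 * x 2 2 = 0 &
      x 0 1 * x 0 2 + x 1 1 * x 1 2 - x 2 1 * x 2 2 = 0].
Proof.
by move=> Ox; rewrite !O21_entries // /lorentz !mxE /=; split; split; ring.
Qed.

Lemma det_boost a : a != 0 -> \det (boost a) = 1.
Proof. by move=> a0; rewrite det3E !mxE /=; field. Qed.

Lemma boostVK a x : a != 0 -> boost a *m (boost a^-1 *m x) = x.
Proof.
move=> a0; rewrite mulmxA -[RHS]mul1mx; congr (_ *m _).
apply/M3P => u; rewrite mul1mx -mulmxA.
by apply/cV3P; rewrite !coordE /= ?invrK; split; field.
Qed.

Lemma boost_nu a : boost a *m nu R = a *: nu R.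
Proof. by rewrite nuE; apply/cV3P; rewrite !coordE /=; split; lra. Qed.

(** The entries of [y] are determined by [y 0 1] once the Gram relations are combined
with [y *m nu = nu]; these leave only the sign of [y 0 0], which is the
determinant. *)
Lemma unip_of_fix_nu y : O21 y -> \det y = 1 -> y *m nu R = nu R ->
  exists t, y = unip t.
Proof.
move=> Oy dy; rewrite nuE => /cV3P; rewrite !coordE /= => -[n0 n1 n2].
have [[g00 g11 _] [g01 g02 g12]] := O21_gram Oy.
rewrite det3E in dy.
have y02 : y 0 2 = y 0 1 by lra.
have y12 : y 1 2 = y 1 1 - 1 by lra.
have y22 : y 2 2 = y 2 1 + 1 by lra.
rewrite y02 y12 y22 in g02 g12 dy.
have s0 : y 2 0 = - y 1 0 by lra.
have s1 : y 2 1 = 1 - y 1 1 by lra.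
rewrite s0 s1 in g00 g11 g01 dy.
have y00 : y 0 0 = 1 by lra.
have y10 : y 1 0 = - y 0 1 by move: g01; rewrite y00; lra.
have y11 : y 1 1 = 1 - y 0 1 ^+ 2 / 2 by lra.
exists (y 0 1); apply/matrixP => i j; rewrite mx3E.
have [->|->|->] := I3P i; have [->|->|->] := I3P j => /=;
  rewrite ?y02 ?y12 ?y22 ?s0 ?s1 ?y00 ?y10 ?y11; ring.
Qed.

(** From above, [H] lies in the group [K] of linear isometries of determinant 1 that
scale [nu] by a positive factor. An element of [K] with factor [m] is the boost
by [m] times an isometry fixing [nu], which is unipotent. *)
Lemma AN_eq H S : lie_group H S ->
  (forall X, S X <-> exists a b, X = (Xi (a *: e1 R + b *: nu R), 0)) ->
  H = AN R.
Proof.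
move=> HS SE; have [HI H1 HM HV] := lie_subgroup HS.
have gA a : S (a *: (Ya R, 0)).
  apply/SE; exists a, 0; rewrite scale0r addr0 Xi_scale YaE.
  by congr pair; exact: scaler0.
have gN a : S (a *: (Yn R, 0)).
  apply/SE; exists 0, a; rewrite scale0r add0r Xi_scale YnE.
  by congr pair; exact: scaler0.
apply/seteqP; split; last first.
  have sub Z : (forall a, S (a *: Z)) -> connected_subgroup <[Z]> `<=` H.
    move=> SZ; rewrite connected_subgroupE (lie_gen HS); apply: generated_min.
      by apply: subgroup_generated; exact: Exp_set_Isom.
    move=> g Hg; apply: sub_generated; apply: Exp_set_mono Hg => X /vlineP[c ->].
    exact: SZ.
  by move=> _ [a Aa [n Nn <-]]; apply: HM; [exact: sub gA _ Aa|exact: sub gN _ Nn].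
pose K : set (aff R) := [set g | [/\ Isom R g, g.2 = 0, \det g.1 = 1 &
  exists2 m, 0 < m & g.1 *m nu R = m *: nu R]].
have sK : subgroup K.
  split=> [g []//||g1 g2 [I1 z1 d1 [m1 m10 e1]] [I2 z2 d2 [m2 m20 e2]]|g [Ig zg dg [m m0 e]]].
  - split; [exact: O21_1|by []|by rewrite det1|].
    by exists 1; rewrite ?ltr01 // mul1mx scale1r.
  - split; [exact: IsomM|by rewrite /= z1 z2 mulmx0 addr0|by rewrite det_mulmx d1 d2 mulr1|].
    by exists (m1 * m2); [exact: mulr_gt0|rewrite -mulmxA e2 -scalemxAr e1 scalerA mulrC].
  - split; [exact: IsomV|by rewrite /= zg mulmx0 oppr0|by rewrite det_inv dg invr1|].
    exists m^-1; first by rewrite invr_gt0.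
    have : invmx g.1 *m (g.1 *m nu R) = nu R by rewrite mulKmx // O21_unit.
    rewrite e -scalemxAr => E; rewrite /= -{2}E scalerA mulVf ?scale1r //.
    by rewrite gt_eqF.
apply: subset_trans (_ : K `<=` _).
  apply: (lie_group_sub HS sK) => gam X t gX /SE [a [b EX]].
  split; [by have [] := gX| |exact: one_param_det gX _|].
    by apply: (one_param_linear gX); rewrite EX.
  exists (expR (a * t)); first exact: expR_gt0.
  apply: (one_param_eigen gX); rewrite EX /= mul_Xi nuE e1E.
  by apply/cV3P; rewrite !coordE /=; split; ring.
move=> [x z] [/= Ox z0 dx [m m0 xm]]; rewrite /Isom /= in Ox.
have mn : m != 0 by rewrite gt_eqF.
have mVn : m^-1 != 0 by rewrite invr_eq0.
have [|||t xt] := @unip_of_fix_nu (boost m^-1 *m x).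
- by apply: O21M => //; exact: O21_boost.
- by rewrite det_mulmx det_boost // dx mulr1.
- by rewrite -mulmxA xm -scalemxAr boost_nu scalerA divff // scale1r.
exists (boost m, 0); last first.
  exists (unip t, 0); last by rewrite /affM /= mulmx0 addr0 -xt boostVK // z0.
  rewrite /grpN connected_subgroupE; apply: (generated_Exp (one_param_unip R)) => /=.
  by apply/vlineP; exists t.
have <- : expR (ln m) = m by rewrite lnK.
rewrite /grpA connected_subgroupE; apply: (generated_Exp (one_param_boost R)) => /=.
by apply/vlineP; exists (ln m).
Qed.

(** The image of a connected set under a continuous function avoiding 0 stays on one
side of 0. *)
Lemma SOo21_sign (f : 'M[R]_3 -> R) x : continuous f ->
  (forall y, O21 y -> f y != 0) -> 0 < f 1%:M -> SOo21 R x -> 0 < f x.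
Proof.
move=> cf f0 f1 SOx.
have Ox y : SOo21 R y -> O21 y by move/connected_component_sub.
have cS : connected (f @` SOo21 R).
  apply: connected_continuous_connected; first exact: component_connected.
  exact: continuous_subspaceT.
have iS := (connected_intervalP _).1 cS.
have S1 : SOo21 R 1%:M by apply: connected_component_refl; exact: O21_1.
rewrite ltNge; apply/negP => fx.
have [y SOy fy] : (f @` SOo21 R) 0.
  by apply: (iS (f x) (f 1%:M)); [exists x|exists 1%:M|rewrite fx ltW].
by have := f0 y (Ox _ SOy); rewrite fy eqxx.
Qed.

Lemma SOo21_det x : SOo21 R x -> \det x = 1.
Proof.
move=> SOx; have Ox : O21 x by apply: connected_component_sub SOx.
have dx : 0 < \det x.
  apply: (@SOo21_sign (fun y => \det y)) => // [|y Oy|]; last by rewrite det1.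
    rewrite (_ : (fun y => _) = fun y : 'M[R]_3 =>
      y 0 0 * (y 1 1 * y 2 2 - y 1 2 * y 2 1)
      - y 0 1 * (y 1 0 * y 2 2 - y 1 2 * y 2 0)
      + y 0 2 * (y 1 0 * y 2 1 - y 1 1 * y 2 0)); last first.
      by apply/funext => y; rewrite det3E.
    have c i j : continuous (fun y : 'M[R]_3 => y i j) by exact: coord_continuous.
    have cM (k l : 'M[R]_3 -> R) : continuous k -> continuous l ->
      continuous (fun y => k y * l y) by move=> ck cl y; exact: cvgM (ck y) (cl y).
    have cB (k l : 'M[R]_3 -> R) : continuous k -> continuous l ->
      continuous (fun y => k y - l y) by move=> ck cl y; exact: cvgB (ck y) (cl y).
    have cD (k l : 'M[R]_3 -> R) : continuous k -> continuous l ->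
      continuous (fun y => k y + l y) by move=> ck cl y; exact: cvgD (ck y) (cl y).
    have minor i j := cM _ _ (c 1 i) (c 2 j).
    exact: (cD _ _ (cB _ _ (cM _ _ (c 0 0) (cB _ _ (minor 1 2) (minor 2 1)))
                  (cM _ _ (c 0 1) (cB _ _ (minor 0 2) (minor 2 0))))
              (cM _ _ (c 0 2) (cB _ _ (minor 0 1) (minor 1 0)))).
  by have := O21_unit Oy; rewrite unitmxE unitfE.
have := O21_det Ox; move: dx; rewrite expr2; nra.
Qed.

(** The diagonal entry cannot vanish on O(2,1), since [x *m e3] has norm -1. *)
Lemma SOo21_future x : SOo21 R x -> 0 < x 2 2.
Proof.
apply: (@SOo21_sign (fun y => y 2 2)) => [|y Oy|]; first exact: coord_continuous.
  have [[_ _ g] _] := O21_gram Oy; apply/eqP => y0; move: g; rewrite y0; nra.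
by rewrite mxE.
Qed.

Lemma rotation_of_fix_e3 y : O21 y -> \det y = 1 -> y *m e3 R = e3 R ->
  exists t, y = rotation (cos t) (sin t).
Proof.
move=> Oy dy; rewrite e3E => /cV3P; rewrite !coordE /= => -[n0 n1 n2].
have [[g00 g11 _] [g01 g02 g12]] := O21_gram Oy.
rewrite det3E in dy.
have y02 : y 0 2 = 0 by lra.
have y12 : y 1 2 = 0 by lra.
have y22 : y 2 2 = 1 by lra.
rewrite y02 y12 y22 in g02 g12 dy.
have y20 : y 2 0 = 0 by lra.
have y21 : y 2 1 = 0 by lra.
rewrite y20 y21 in g00 g11 g01 dy.
(* The two columns are unit vectors with determinant 1. *)
have E : (y 1 1 - y 0 0) ^+ 2 + (y 0 1 + y 1 0) ^+ 2 = 0 by lra.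
have y11 : y 1 1 = y 0 0.
  apply/eqP; rewrite -subr_eq0 -sqrf_eq0; apply/eqP.
  have := sqr_ge0 (y 1 1 - y 0 0); have := sqr_ge0 (y 0 1 + y 1 0); lra.
have y01 : y 0 1 = - y 1 0.
  apply/eqP; rewrite -addr_eq0 -sqrf_eq0; apply/eqP.
  have := sqr_ge0 (y 1 1 - y 0 0); have := sqr_ge0 (y 0 1 + y 1 0); lra.
have [|t [ct st]] := @circle_cos_sin R (y 0 0) (y 1 0); first by rewrite !expr2; lra.
exists t; rewrite -ct -st; apply/matrixP => i j; rewrite mx3E.
by have [->|->|->] := I3P i; have [->|->|->] := I3P j.
Qed.

(** The inclusion of the identity component in [H] is the KAK argument: a rotation
and a boost bring [x *m e3] back to [e3], and an isometry of determinant 1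
fixing [e3] is a rotation. *)
Lemma SO_eq H S : lie_group H S -> H `<=` Isomo R ->
  (forall X, S X <-> exists u, X = (Xi u, 0)) ->
  H = linear_group (SOo21 R).
Proof.
move=> HS HSO SE; have [HI H1 HM HV] := lie_subgroup HS.
apply/seteqP; split=> [h Hh|_ [x SOx <-]].
  exists h.1; first exact: HSO.
  pose K : set (aff R) := [set g | Isom R g /\ g.2 = 0].
  have sK : subgroup K.
    split=> [g []//||g1 g2 [I1 z1] [I2 z2]|g [Ig zg]].
    - by split; [exact: O21_1|].
    - by split; [exact: IsomM|rewrite /= z1 z2 mulmx0 addr0].
    - by split; [exact: IsomV|rewrite /= zg mulmx0 oppr0].
  suff [_ <-] : K h by rewrite -surjective_pairing.
  apply: (lie_group_sub HS sK) Hh => gam X t gX /SE [y EX].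
  by split; [have [] := gX|apply: (one_param_linear gX); rewrite EX].
have Hrot c s : c ^+ 2 + s ^+ 2 = 1 -> H (rotation c s, 0).
  move=> /circle_cos_sin[t [-> ->]].
  apply: (lie_exp HS (one_param_rotation R)); apply/SE; exists (t *: e3 R).
  by rewrite Xi_scale YkE; congr pair; exact: scaler0.
have Hboost a : 0 < a -> H (boost a, 0).
  move=> a0; have <- : expR (ln a) = a by rewrite lnK.
  apply: (lie_exp HS (one_param_boost R)); apply/SE; exists (ln a *: e1 R).
  by rewrite Xi_scale YaE; congr pair; exact: scaler0.
have Ox : O21 x by apply: connected_component_sub SOx.
have [c [s [r [cs r0 E]]]] := rotation_align (x *m e3 R).
set z := (x *m e3 R) 2 0 in E.
have z0 : 0 < z by rewrite /z e3E !coordE /= !mulr0 !add0r mulr1; exact: SOo21_future.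
have rz : r ^+ 2 - z ^+ 2 = -1.
  have := O21_rotation cs (x *m e3 R) (x *m e3 R); rewrite Ox E e3E /lorentz !vec3s; lra.
have [|a a0 [k ak]] := @boost_align R r z; first by apply/eqP => h; rewrite h subrr in rz; lra.
have an : a != 0 by rewrite gt_eqF.
pose b := boost a *m rotation c s.
have Ob : O21 b by apply: O21M; [exact: O21_boost|exact: O21_rotation].
have be3 : b *m x *m e3 R = e3 R.
  have := O21_boost an (vec3 0 r z) (vec3 0 r z).
  rewrite -!mulmxA E; case: ak => ak; rewrite ak /lorentz !vec3s => k2.
    by exfalso; have := sqr_ge0 k; rewrite expr2; lra.
  have k0 : 0 < k.
    have -> : k = (a^-1 * (r + z) + a * (z - r)) / 2.
      by move/cV3P : ak; rewrite !coordE /= => -[_ _ <-]; ring.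
    have zr : 0 < z - r by nra.
    apply: divr_gt0 => //; apply: addr_gt0; apply: mulr_gt0 => //; last lra.
    by rewrite invr_gt0.
  by rewrite e3E; congr vec3; nra.
have [||t bt] := rotation_of_fix_e3 _ _ be3.
- exact: O21M.
- rewrite !det_mulmx det_boost // (SOo21_det SOx) !mulr1 mul1r.
  by rewrite det3E !mxE /=; lra.
have -> : (x, 0) = affM (affV (affM (boost a, 0) (rotation c s, 0)))
    (rotation (cos t) (sin t), 0) :> aff R.
  rewrite -bt /affM /affV /= !mulmx0 !addr0 !mulmx0 oppr0 addr0.
  by rewrite mulKmx // O21_unit.
apply: (HM _ _ (HV _ (HM _ _ (Hboost _ a0) (Hrot _ _ cs)))).
by apply: Hrot; exact: cos2Dsin2.
Qed.

End AN_SO.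

(** * From the group to its Lie algebra; spans via the cross product *)

Section Reduction.
Variable R : realType.
Implicit Types (x : 'M[R]_3) (y p q u v w n : 'cV[R]_3).
Implicit Types (g h X Y : aff R) (s t a b c : R).
Implicit Types (H G K S : set (aff R)).

Lemma lie_groupP H : connected_Lie_subgroup H -> lie_group H (lie_algebra H).
Proof.
move=> [sH [h [hE hb gE]]]; rewrite hE; split=> //.
- exact: mem0v.
- by move=> a X Y hX hY; apply: memvD => //; exact: memvZ.
Qed.

Lemma cross_eq0 u v : cross u v = 0 ->
  exists a b, (a != 0) || (b != 0) /\ a *: u + b *: v = 0.
Proof.
move/cV3P; rewrite /cross !vec3s !mxE => -[h0 h1 h2].
have [u0|u0] := eqVneq u 0.
  by exists 1, 0; rewrite oner_eq0 u0 scaler0 scale0r addr0.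
have [i ui] : exists i, u i 0 != 0.
  apply: contrapT => ui; case/eqP: u0; apply/matrixP => i j; rewrite mxE (ord1 j).
  by apply/eqP/negP => /negP ui0; apply: ui; exists i.
exists (- v i 0), (u i 0); rewrite ui orbT; split=> //.
by apply/cV3P; rewrite !mxE; have [->|->|->] := I3P i; split; lra.
Qed.

Lemma dep_cross u v a b : (a != 0) || (b != 0) -> a *: u + b *: v = 0 -> cross u v = 0.
Proof.
move=> ab E.
have Eu : a *: cross u v = cross (a *: u + b *: v) v.
  by apply/cV3P; rewrite !coordE /=; split; ring.
have Ev : b *: cross u v = cross u (a *: u + b *: v).
  by apply/cV3P; rewrite !coordE /=; split; ring.
have c0 w : (cross 0 w = 0) * (cross w 0 = 0).
  by split; apply/cV3P; rewrite !coordE /=; split; ring.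
move: Eu Ev; rewrite E !c0 => /eqP Eu /eqP Ev.
by move: Eu Ev; rewrite !scaler_eq0; case/orP: ab => /negPf -> /= => [/eqP|_ /eqP].
Qed.

Lemma cramer u v w : lorentz (cross u v) w != 0 ->
  forall q, exists a b c, q = a *: u + b *: v + c *: w.
Proof.
rewrite lorentz_cross => D0 q; set M := columns u v w.
have MU : M \in unitmx by rewrite unitmxE unitfE.
set k := invmx M *m q; exists (k 0 0), (k 1 0), (k 2 0).
rewrite -[LHS](mulKVmx MU) -/k.
by apply/cV3P; rewrite !mulmx3E !mxE /=; split; ring.
Qed.

(** The plane spanned by [u] and [v] is the Lorentz complement of their cross
product, even when that product is null and lies in the plane. *)
Lemma span_of_orthogonal u v q : cross u v != 0 -> lorentz (cross u v) q = 0 ->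
  exists a b, q = a *: u + b *: v.
Proof.
move=> n0 nq; have [w nw] : exists w, lorentz (cross u v) w != 0.
  apply: contrapT => nw; case/eqP: n0; apply: lorentz_nondeg => w.
  by apply/eqP/negP => /negP ?; apply: nw; exists w.
have [a [b [c E]]] := cramer nw q.
exists a, b; suff c0 : c = 0 by rewrite E c0 scale0r addr0.
have : lorentz (cross u v) q = c * lorentz (cross u v) w.
  by rewrite E /lorentz !coordE /=; ring.
by rewrite nq => /esym/eqP; rewrite mulf_eq0 (negPf nw) orbF => /eqP.
Qed.

(** A basis of the 2-dimensional velocity space given by the codimension condition
has nonzero cross product, because it is free. *)
Lemma cohom1P H : cohomogeneity H 1 -> cohom1 (lie_algebra H).
Proof.
move=> [[p [V VE dV]] codim]; split=> [p'|].
  apply: contrapT => Hq.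
  suff /codim : orbit_codim H p' 0 by [].
  exists fullv; last by rewrite dimvf /dim /= addn0.
  apply/seteqP; split=> q _ /=; first exact: memvf.
  apply: contrapT => nq; apply: Hq; exists q => X SX E; apply: nq; by exists X.
have {}dV : \dim V = 2%N by apply/eqP; rewrite -(eqn_add2r 1) dV.
have := vbasisP V; case: (vbasis V) => bs /=; rewrite dV.
case: bs => [|u [|v [|? ?]]] //= _ /andP[/eqP sV fV].
exists p, u, v; split.
  apply/eqP => /cross_eq0[a [b [ab E]]]; move: fV.
  rewrite free_cons span_seq1 seq1_free => /andP[uv v0].
  have [a0|a0] := eqVneq a 0.
    move: ab E; rewrite a0 eqxx /= scale0r add0r => b0 /eqP.
    by rewrite scaler_eq0 (negPf b0) (negPf v0).
  case/vlineP: uv; exists (- (b / a)); apply: (scalerI a0).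
  by rewrite scaleNr scalerN scalerA mulrCA divff // mulr1; apply/eqP; rewrite -addr_eq0 E.
move=> q; split=> [[X SX E]|[a [b ->]]].
  have : q \in V by have : orbit_tangent H p q by [exists X]; rewrite VE.
  rewrite -sV span_cons span_seq1 => /memv_addP[_ /vlineP[a ->] [_ /vlineP[b ->] ->]].
  by exists a, b.
have : a *: u + b *: v \in V.
  by rewrite -sV span_cons span_seq1; apply: memv_add; exact: memvZ (memv_line _).
by move=> Vq; have : [set` V] (a *: u + b *: v) by []; rewrite -VE => -[X SX E]; exists X.
Qed.

Lemma lie_so21 H S X : lie_group H S -> S X -> exists u, X.1 = Xi u.
Proof. by move=> HS; rewrite -(lie_alg HS) => -[gam gX _]; exact: one_param_so21 gX. Qed.

Lemma lieZ H S X a : lie_group H S -> S X -> S (a *: X).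
Proof. by move=> HS SX; rewrite -[_ *: _]addr0; exact: lie_lin HS _ _ _ SX (lie_0 HS). Qed.

Lemma orbits_equivalent H G : orbits H = orbits G -> orbit_equivalent H G.
Proof.
move=> E; exists (aff1 R); first exact: O21_1.
rewrite -E; apply/seteqP.
have idO (O : set 'cV[R]_3) : act (aff1 R) @` O = O.
  by apply/seteqP; split=> [_ [r Or <-]|r Or]; [|exists r]; rewrite ?act1.
by split=> [_ [A HA <-]|A HA]; [rewrite idO|exists A; rewrite ?idO].
Qed.

Lemma Isom_trans w : Isom R (1%:M, w).
Proof. exact: O21_1. Qed.

Lemma Isom_lin x : O21 x -> Isom R (x, 0).
Proof. by []. Qed.

(** Moving the origin by [w] changes the translation part by a coboundary. *)
Lemma Ad_set_trans w S X :
  Ad_set (1%:M, w) S X = S (X.1, X.2 + X.1 *m w).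
Proof.
rewrite /Ad_set /Ad /affV /= invmx1 invmx1; congr (S (_, _)).
  by rewrite mulmx1 mul1mx.
by rewrite !mul1mx mulmx1 mulmxN opprK.
Qed.

Lemma Ad_set_lin x S X : O21 x ->
  Ad_set (x, 0) S X <-> exists2 X0, S X0 & X = (x *m X0.1 *m invmx x, x *m X0.2).
Proof.
move=> Ox; have xU := O21_unit Ox.
have E X0 : Ad (x, 0) X0 = (x *m X0.1 *m invmx x, x *m X0.2).
  by rewrite /Ad /= mulmx0 subr0.
split=> [SX|[X0 SX0 ->]]; last by rewrite -E; exact: Ad_set_mem.
by exists (Ad (affV (x, 0)) X); rewrite // -E AdVK.
Qed.

End Reduction.

(** * Lie algebras containing a plane of translations *)

Section Cases.
Variable R : realType.
Implicit Types (x : 'M[R]_3) (y p q u v w n : 'cV[R]_3).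
Implicit Types (g h X Y : aff R) (s t a b c : R).
Implicit Types (H G K S : set (aff R)).

Lemma Ad_set_translations x S v : O21 x ->
  Ad_set (x, 0) S (0, v) <-> S (0, invmx x *m v).
Proof.
move=> Ox; have xU := O21_unit Ox.
rewrite Ad_set_lin //; split=> [[[A a] SX [/(congr1 (fun B => invmx x *m B *m x)) A0 ->]]|SX].
  move: A0 SX; rewrite mulKmx // mulmx0 mul0mx -mulmxA !mulmxA mulVmx // mul1mx.
  by rewrite -mulmxA mulVmx // mulmx1 => <-.
by exists (0, invmx x *m v); rewrite //= mulmx0 mul0mx mulKVmx.
Qed.

Lemma memv_R2 v : (v \in R2 R) = (v 2 0 == 0).
Proof.
apply/idP/eqP => [/memv_addP[_ /vlineP[a ->] [_ /vlineP[b ->] ->]]|v0].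
  by rewrite e1E e2E !coordE /=; ring.
have -> : v = v 0 0 *: e1 R + v 1 0 *: e2 R.
  by rewrite e1E e2E; apply/cV3P; rewrite !coordE /= v0; split; ring.
by apply: memv_add; exact: memvZ (memv_line _).
Qed.

Lemma memv_L2 v : (v \in L2 R) = (v 0 0 == 0).
Proof.
apply/idP/eqP => [/memv_addP[_ /vlineP[a ->] [_ /vlineP[b ->] ->]]|v0].
  by rewrite e2E e3E !coordE /=; ring.
have -> : v = v 1 0 *: e2 R + v 2 0 *: e3 R.
  by rewrite e2E e3E; apply/cV3P; rewrite !coordE /= v0; split; ring.
by apply: memv_add; exact: memvZ (memv_line _).
Qed.

Lemma memv_W2 v : (v \in W2 R) = (v 1 0 + v 2 0 == 0).
Proof.
apply/idP/eqP => [/memv_addP[_ /vlineP[a ->] [_ /vlineP[b ->] ->]]|v0].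
  by rewrite -/(nu R) e1E nuE !coordE /=; ring.
have -> : v = v 0 0 *: e1 R + v 1 0 *: nu R.
  by rewrite e1E nuE; apply/cV3P; rewrite !coordE /=; split; lra.
by apply: memv_add; exact: memvZ (memv_line _).
Qed.

(** A velocity transversal to the plane of translations would give, together with
that plane, all velocities at its point. *)
Lemma plane_case H S u v : lie_group H S -> cohom1 S ->
  S (0, u) -> S (0, v) -> cross u v != 0 ->
  [\/ orbit_equivalent H (translations (R2 R)),
      orbit_equivalent H (translations (L2 R)) |
      orbit_equivalent H (translations (W2 R))].
Proof.
move=> HS cS Su Sv; set n := cross u v => n0.
have ST q : lorentz n q = 0 -> S (0, q).
  move=> nq; have [a [b ->]] := span_of_orthogonal n0 nq.
  have := lie_lin HS a Su (lieZ b HS Sv).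
  by congr S; congr pair; rewrite /= ?scaler0 ?addr0.
have SV X q : S X -> lorentz n (velocity X q) = 0.
  move=> SX; apply: contrapT => /eqP nX.
  have [r Hr] := no_open_orbit cS q.
  set k := lorentz n r / lorentz n (velocity X q).
  have Sr : S (0, r - k *: velocity X q).
    apply: ST; rewrite lorentzBr /k; set D := lorentz n (velocity X q) in nX *.
    have -> : lorentz n ((lorentz n r / D) *: velocity X q) = lorentz n r / D * D.
      by rewrite /D /lorentz !mxE; ring.
    by rewrite divfK // subrr.
  apply: (Hr _ (lie_lin HS k SX Sr)); rewrite /velocity /= addr0 -scalemxAl.
  by rewrite addrA -scalerDr addrC subrK.
have [x Ox [c c0 xn]] := O21_normal_form n0.
have xU := O21_unit Ox.
have HS' := lie_group_conj (Isom_lin Ox) HS.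
suff E (V : {vspace 'cV[R]_3}) : (forall w, (w \in V) = (lorentz (x *m n) w == 0)) ->
    orbit_equivalent H (translations V).
  case: xn => xn; [apply: Or31|apply: Or32|apply: Or33]; apply: E => w; rewrite xn.
  - rewrite memv_R2 e3E /lorentz !coordE /= !mulr0 !mul0r !add0r mulr1.
    by rewrite oppr_eq0 mulf_eq0 (negPf c0).
  - rewrite memv_L2 e1E /lorentz !coordE /= !mulr0 !mul0r !addr0 subr0 mulr1.
    by rewrite mulf_eq0 (negPf c0).
  - rewrite memv_W2 nuE /lorentz !coordE /=.
    rewrite (_ : _ - _ = c * (w 1 0 + w 2 0)); last ring.
    by rewrite mulf_eq0 (negPf c0).
move=> VE; apply: (orbit_equivalent_conj (Isom_lin Ox)); apply: orbits_equivalent.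
apply: (orbits_plane HS' VE) => [X q|w].
  rewrite Ad_set_lin // => -[X0 SX0 ->]; rewrite VE /velocity /=; apply/eqP.
  rewrite -!mulmxA -mulmxDr Ox; exact: SV.
rewrite VE => /eqP nw; apply/(Ad_set_translations _ _ Ox); apply: ST.
by rewrite -(Ox n) mulKVmx.
Qed.

End Cases.

(** * Lie algebras containing exactly a line of translations *)

Section LineCases.
Variable R : realType.
Implicit Types (x : 'M[R]_3) (y p q u v w n : 'cV[R]_3).
Implicit Types (g h X Y : aff R) (s t a b c : R).
Implicit Types (H G K S : set (aff R)).

Definition line_of_translations S u :=
  forall v, S (0, v) <-> exists b, v = b *: u.

(** When the linear parts form a line [R Y] and the translations a line [R u], the
Lie algebra is spanned by [(Y, v)] and [(0, u)]. Only [v] modulo the image of [Y]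
and modulo [u] matters: the decomposition [v = Y *m w + z + c *: u] leaves [z]
after moving the origin by [w]. *)
Lemma translate_line_algebra H S (Y : 'M[R]_3) u w z c : lie_group H S ->
  (forall X, S X -> exists a, X.1 = a *: Y) ->
  line_of_translations S u ->
  S (Y, Y *m w + z + c *: u) ->
  forall X, Ad_set (1%:M, w) S X <-> exists a b, X = (a *: Y, a *: z + b *: u).
Proof.
move=> HS SY Su S0 X; rewrite Ad_set_trans.
have {}S0 : S (Y, Y *m w + z).
  have Sc : S (0, c *: u) by apply/Su; exists c.
  have := lie_lin HS (-1) Sc S0; congr S; congr pair => /=.
    by rewrite scaler0 add0r.
  by rewrite scaleN1r addrC addrK.
split=> [SX|[a [b ->]]] /=.
  have [a /= EX] := SY _ SX; move: SX; rewrite EX => SX.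
  have : S (0, X.2 - a *: z).
    have := lie_lin HS (- a) S0 SX; congr S; congr pair => /=.
      by rewrite scaleNr addNr.
    by rewrite scaleNr scalerDr -scalemxAl opprD addrC addrA addrK.
  move=> /Su[b Eb]; exists a, b.
  by rewrite -Eb addrC subrK -EX -surjective_pairing.
have Sb : S (0, b *: u) by apply/Su; exists b.
have := lie_lin HS a S0 Sb; congr S; congr pair => /=; first by rewrite addr0.
by rewrite scalerDr -scalemxAl -addrA addrC.
Qed.

(** Otherwise all velocities are multiples of [u], and no velocity space is a plane. *)
Lemma line_rotational_part S u : cohom1 S -> line_of_translations S u ->
  exists2 X, S X & X.1 != 0.
Proof.
move=> [_ [p [v1 [v2 [n0 E]]]]] Su; apply: contrapT => nX.
have ES q : (exists2 X, S X & velocity X p = q) -> exists b, q = b *: u.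
  move=> [[A a] SX <-]; have A0 : A = 0.
    by apply/eqP/negP => /negP A0; apply: nX; exists (A, a).
  by rewrite /velocity /= A0 mul0mx add0r; apply/Su; rewrite -A0.
have [b1 E1] : exists b, v1 = b *: u.
  by apply/ES/E; exists 1, 0; rewrite scale1r scale0r addr0.
have [b2 E2] : exists b, v2 = b *: u.
  by apply/ES/E; exists 0, 1; rewrite scale1r scale0r add0r.
case/eqP: n0; rewrite E1 E2; apply/cV3P; rewrite !coordE /=; split; ring.
Qed.

(** The bracket with the translation [u] is the translation [cross y u]. *)
Lemma line_invariant H S u y v : lie_group H S -> line_of_translations S u ->
  S (Xi y, v) -> exists b, cross y u = b *: u.
Proof.
move=> HS Su SX; have S0 : S (0, u) by apply/Su; exists 1; rewrite scale1r.
have := lie_bracket HS SX S0; rewrite /bracket /= mulmx0 !mul0mx !subr0 mul_Xi.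
by move/Su.
Qed.

Lemma unit_rotational_part H S (Y : 'M[R]_3) : lie_group H S ->
  (forall X, S X -> exists a, X.1 = a *: Y) -> (exists2 X, S X & X.1 != 0) ->
  exists v, S (Y, v).
Proof.
move=> HS SY [X SX X0]; have [a Xa] := SY _ SX.
have a0 : a != 0 by apply: contra_neq X0 => a0; rewrite Xa a0 scale0r.
exists (a^-1 *: X.2); have := lieZ a^-1 HS SX; congr S; congr pair => /=.
by rewrite Xa scalerA mulVf // scale1r.
Qed.

(** Since [cross y e3] is orthogonal to [e3], it can only be a multiple of [e3] if it
vanishes, that is, if [y] is a multiple of [e3]. *)
Lemma line_e3_case H S : lie_group H S -> cohom1 S ->
  line_of_translations S (e3 R) -> orbit_equivalent H (K_Re3 R).
Proof.
move=> HS cS Su; have SY X : S X -> exists a, X.1 = a *: Yk R.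
  move=> SX; have [y Xy] := lie_so21 HS SX; exists (y 2 0).
  have [b /cV3P] : exists b, cross y (e3 R) = b *: e3 R.
    apply: (line_invariant (v := X.2) HS Su); by rewrite -Xy -surjective_pairing.
  rewrite e3E !coordE /= => -[h0 h1 _].
  rewrite Xy YkE e3E -Xi_scale; congr Xi.
  by apply/cV3P; rewrite !coordE /=; split; lra.
have [v Sv] := unit_rotational_part HS SY (line_rotational_part cS Su).
pose w : 'cV[R]_3 := vec3 (v 1 0) (- v 0 0) 0.
have Sw : S (Yk R, Yk R *m w + 0 + v 2 0 *: e3 R).
  move: Sv; congr S; congr pair; rewrite /w YkE mul_Xi e3E.
  by apply/cV3P; rewrite !coordE /=; split; ring.
apply: (orbit_equivalent_conj (Isom_trans w)); apply: orbits_equivalent; congr orbits.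
apply: (generated_line_product (lie_group_conj (Isom_trans w) HS)) => [X|].
  rewrite (translate_line_algebra HS SY Su Sw).
  by split=> -[a [b ->]]; exists a, b; rewrite scaler0 add0r.
by rewrite YkE mul_Xi e3E; apply/cV3P; rewrite !coordE /=; split; ring.
Qed.

Lemma line_e1_case H S : lie_group H S -> cohom1 S ->
  line_of_translations S (e1 R) -> orbit_equivalent H (A_Re1 R).
Proof.
move=> HS cS Su; have SY X : S X -> exists a, X.1 = a *: Ya R.
  move=> SX; have [y Xy] := lie_so21 HS SX; exists (y 0 0).
  have [b /cV3P] : exists b, cross y (e1 R) = b *: e1 R.
    apply: (line_invariant (v := X.2) HS Su); by rewrite -Xy -surjective_pairing.
  rewrite e1E !coordE /= => -[_ h1 h2].
  rewrite Xy YaE e1E -Xi_scale; congr Xi.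
  by apply/cV3P; rewrite !coordE /=; split; lra.
have [v Sv] := unit_rotational_part HS SY (line_rotational_part cS Su).
pose w : 'cV[R]_3 := vec3 0 (- v 2 0) (- v 1 0).
have Sw : S (Ya R, Ya R *m w + 0 + v 0 0 *: e1 R).
  move: Sv; congr S; congr pair; rewrite /w YaE mul_Xi e1E.
  by apply/cV3P; rewrite !coordE /=; split; ring.
apply: (orbit_equivalent_conj (Isom_trans w)); apply: orbits_equivalent; congr orbits.
apply: (generated_line_product (lie_group_conj (Isom_trans w) HS)) => [X|].
  rewrite (translate_line_algebra HS SY Su Sw).
  by split=> -[a [b ->]]; exists a, b; rewrite scaler0 add0r.
by rewrite YaE mul_Xi e1E; apply/cV3P; rewrite !coordE /=; split; ring.
Qed.

Lemma monic_quadratic_nonzero b c : exists s, s ^+ 2 + b * s + c != 0.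
Proof.
apply: contrapT => H; have Z s : s ^+ 2 + b * s + c = 0.
  by apply/eqP/negP => /negP ?; apply: H; exists s.
have := (Z 0, Z 1, Z (-1)); rewrite !expr2 => -[[z0 z1] z2]; lra.
Qed.

(** Modulo [nu], in the coordinates [p 0 0] and [s = p 1 0 + p 2 0], the velocities of
the two elements at [p] are [(u 0 0, us - s)] and [(s + v 0 0, vs)]. Their determinant
is a monic quadratic polynomial in [s], so for some [s] the velocities together
with [nu] fill L^3. *)
Lemma open_orbit_W2 H S u v : lie_group H S -> cohom1 S ->
  line_of_translations S (nu R) -> S (Ya R, u) -> S (Yn R, v) -> False.
Proof.
move=> HS cS Su SA SN.
pose us := u 1 0 + u 2 0; pose vs := v 1 0 + v 2 0.
have [s D0] := monic_quadratic_nonzero (v 0 0 - us) (u 0 0 * vs - us * v 0 0).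
set D := _ + _ in D0.
have [q Hq] := no_open_orbit cS (vec3 0 s 0).
pose qs := q 1 0 + q 2 0.
(* Cramer's rule modulo nu; the remainder r is then a multiple of nu. *)
pose a := (q 0 0 * vs - (s + v 0 0) * qs) / D.
pose b := (u 0 0 * qs - q 0 0 * (us - s)) / D.
pose r := q - (a *: velocity (Ya R, u) (vec3 0 s 0) + b *: velocity (Yn R, v) (vec3 0 s 0)).
have Sr : S (0, r).
  apply/Su; exists (r 1 0).
  have r0 : r 0 0 = 0.
    rewrite /r /velocity /= YaE YnE !mul_Xi e1E nuE !coordE /= -/us -/vs.
    rewrite /a /b; apply: (mulfI D0); rewrite mulr0.
    transitivity (D * q 0 0 - (q 0 0 * vs - (s + v 0 0) * qs) * u 0 0
      - (u 0 0 * qs - q 0 0 * (us - s)) * (s + v 0 0)); first by field.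
    by rewrite /D; ring.
  have rs : r 1 0 + r 2 0 = 0.
    rewrite /r /velocity /= YaE YnE !mul_Xi e1E nuE !coordE /=.
    rewrite /a /b; apply: (mulfI D0); rewrite mulr0.
    transitivity (D * qs - (q 0 0 * vs - (s + v 0 0) * qs) * (us - s)
      - (u 0 0 * qs - q 0 0 * (us - s)) * vs); first by rewrite /qs /us /vs; field.
    by rewrite /D; ring.
  have L (z : 'cV[R]_3) : z 0 0 = 0 -> z 1 0 + z 2 0 = 0 -> z = z 1 0 *: nu R.
    by move=> z0 zs; rewrite nuE; apply/cV3P; rewrite !coordE /=; split; lra.
  exact: L.
have SX := lie_lin HS a SA (lie_lin HS b SN Sr).
apply: (Hq _ SX); rewrite /r /velocity /=.
rewrite addr0 mulmxDl -!scalemxAl !scalerDr.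
by apply/cV3P; rewrite !mxE; split; ring.
Qed.

Lemma memv_line2 (Y1 Y2 X : aff R) :
  X \in (<[Y1]> + <[Y2]>)%VS <-> exists a b, X = a *: Y1 + b *: Y2.
Proof.
split=> [/memv_addP[_ /vlineP[a ->] [_ /vlineP[b ->] ->]]|[a [b ->]]].
  by exists a, b.
by apply: memv_add; exact: memvZ (memv_line _).
Qed.

Lemma connected_subgroup_eq H S (h : {vspace aff R}) : lie_group H S ->
  (forall X, S X <-> X \in h) -> H = connected_subgroup h.
Proof.
move=> HS Sh; rewrite (lie_gen HS) connected_subgroupE; congr (generated (Exp_set _)).
by apply/seteqP; split=> X; rewrite /= Sh.
Qed.

(** The reflection changing the sign of the first coordinate commutes with [Ya],
fixes [nu] and reverses [e1], so [c] may be assumed nonnegative. *)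
Lemma Alam_case H S c : lie_group H S ->
  (forall X, S X <-> exists a b, X = (a *: Ya R, a *: (c *: e1 R) + b *: nu R)) ->
  exists lam : R, 0 <= lam /\ orbit_equivalent H (Alam_ell lam).
Proof.
wlog c0 : H S c / 0 <= c.
  move=> W HS SE; have [c0|c0] := leP 0 c; first exact: W c0 HS SE.
  have Oref : O21 (reflection (-1 : R) 1) by apply: O21_reflection; ring.
  have IR := Isom_lin Oref.
  have [||lam [lam0 E]] := W _ _ (- c) _ (lie_group_conj IR HS).
  - by rewrite oppr_ge0 ltW.
  - move=> X; rewrite Ad_set_lin //.
    have E a b : (reflection (-1 : R) 1 *m (a *: Ya R) *m invmx (reflection (-1 : R) 1),
        reflection (-1 : R) 1 *m (a *: (c *: e1 R) + b *: nu R)) =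
        (a *: Ya R, a *: (- c *: e1 R) + b *: nu R).
      congr pair.
        rewrite -scalemxAr -scalemxAl YaE Xi_conj // -!Xi_scale; congr Xi.
        by rewrite det3E e1E; apply/cV3P; rewrite !coordE /=; split; ring.
      by rewrite e1E nuE; apply/cV3P; rewrite !coordE /=; split; ring.
    split=> [[X0 /SE[a [b ->]] ->]|[a [b ->]]]; first by exists a, b; rewrite -E.
    by exists (a *: Ya R, a *: (c *: e1 R) + b *: nu R); [apply/SE; exists a, b|rewrite -E].
  - by exists lam; split=> //; exact: orbit_equivalent_conj IR E.
move=> HS SE; exists c; split=> //; apply: orbits_equivalent; congr orbits.
apply: (connected_subgroup_eq HS) => X; rewrite SE memv_line2.
by split=> -[a [b ->]]; exists a, b; congr pair; rewrite /= ?scaler0 ?addr0.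
Qed.

(** The reflection in the first coordinate changes the sign of [Yn] only, so [c] may
be assumed positive. A boost by [k] multiplies [Yn] by [k] and, modulo [nu], [e3]
by [k^-1], so it divides [c] by [k ^+ 2]. *)
Lemma Nlam_case H S c : lie_group H S ->
  (forall X, S X <-> exists a b, X = (a *: Yn R, a *: (c *: e3 R) + b *: nu R)) ->
  orbit_equivalent H (N_ell R) \/ orbit_equivalent H (Nlam_ell 1).
Proof.
have [->|] := eqVneq c 0.
  move=> HS SE; left; apply: orbits_equivalent; congr orbits.
  apply: (generated_line_product HS) => [X|].
    by rewrite SE; split=> -[a [b ->]]; exists a, b; rewrite scale0r scaler0 add0r.
  by rewrite YnE mul_Xi nuE; apply/cV3P; rewrite !coordE /=; split; ring.
wlog c0 : H S c / 0 < c.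
  move=> W cn HS SE; have [c0|c0|c0] := ltgtP 0 c; last by rewrite c0 eqxx in cn.
    exact: W c0 cn HS SE.
  have Oref : O21 (reflection (-1 : R) 1) by apply: O21_reflection; ring.
  have IR := Isom_lin Oref.
  have [|||E|E] := W _ _ (- c) _ _ (lie_group_conj IR HS).
  - by rewrite oppr_gt0.
  - by rewrite oppr_eq0.
  - move=> X; rewrite Ad_set_lin //.
    have E a b : (reflection (-1 : R) 1 *m (a *: Yn R) *m invmx (reflection (-1 : R) 1),
        reflection (-1 : R) 1 *m (a *: (c *: e3 R) + b *: nu R)) =
        (- a *: Yn R, - a *: (- c *: e3 R) + b *: nu R).
      congr pair.
        rewrite -scalemxAr -scalemxAl YnE Xi_conj // -!Xi_scale; congr Xi.
        by rewrite det3E nuE; apply/cV3P; rewrite !coordE /=; split; ring.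
      by rewrite e3E nuE; apply/cV3P; rewrite !coordE /=; split; ring.
    split=> [[X0 /SE[a [b ->]] ->]|[a [b ->]]]; first by exists (- a), b; rewrite -E.
    exists (- a *: Yn R, - a *: (c *: e3 R) + b *: nu R); first by apply/SE; exists (- a), b.
    by rewrite E opprK.
  - by left; exact: orbit_equivalent_conj IR E.
  - by right; exact: orbit_equivalent_conj IR E.
move=> _ HS SE; right; pose k := Num.sqrt c.
have k0 : k != 0 by rewrite gt_eqF // sqrtr_gt0.
have ck : c = k ^+ 2 by rewrite sqr_sqrtr // ltW.
have Ob := O21_boost k0; have Ib := Isom_lin Ob.
apply: (orbit_equivalent_conj Ib); apply: orbits_equivalent; congr orbits.
apply: (connected_subgroup_eq (lie_group_conj Ib HS)) => X.
rewrite Ad_set_lin // memv_line2.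
have E a b : (boost k *m (a *: Yn R) *m invmx (boost k),
    boost k *m (a *: (c *: e3 R) + b *: nu R)) =
    (a * k) *: (Yn R, 1 *: e3 R) + (a * c * (k^-1 - k) / 2 + b * k) *: (0, e2 R - e3 R) :> aff R.
  rewrite ck; congr pair; rewrite /= -/(nu R).
    rewrite -scalemxAr -scalemxAl YnE Xi_conj // det_boost // scale1r.
    by rewrite boost_nu Xi_scale scalerA scaler0 addr0.
  by rewrite e3E nuE; apply/cV3P; rewrite !coordE /=; split; field.
split=> [[X0 /SE[a [b ->]] ->]|[a [b ->]]].
  by rewrite E; do 2!eexists.
pose a' := a / k; pose b' := (b - a' * c * (k^-1 - k) / 2) / k.
exists (a' *: Yn R, a' *: (c *: e3 R) + b' *: nu R); first by apply/SE; exists a', b'.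
by rewrite E; congr (_ *: _ + _ *: _); rewrite /b' /a' ?ck; field.
Qed.

End LineCases.

(** * The null line, and Lie algebras without translations *)

Section Final.
Variable R : realType.
Implicit Types (x : 'M[R]_3) (y p q u v w n : 'cV[R]_3).
Implicit Types (g h X Y : aff R) (s t a b c : R).
Implicit Types (H G K S : set (aff R)).

Lemma line_conj x S u : O21 x -> line_of_translations S u ->
  line_of_translations (Ad_set (x, 0) S) (x *m u).
Proof.
move=> Ox Su v; have xU := O21_unit Ox.
rewrite (Ad_set_translations S v Ox) Su; split=> -[b E]; exists b.
  by rewrite scalemxAr -E mulKVmx.
by rewrite E -scalemxAr mulKmx.
Qed.

Lemma line_scale S u c : c != 0 -> line_of_translations S (c *: u) ->
  line_of_translations S u.
Proof.
move=> c0 Su v; rewrite Su; split=> -[b ->]; first by exists (b * c); rewrite scalerA.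
by exists (b / c); rewrite scalerA divfK.
Qed.

(** The linear parts are combinations of [Ya] and [Yn]. If some of them involves [Ya],
they are all proportional to it, and a unipotent conjugation, which fixes [nu],
turns it into a multiple of [Ya]. *)
Lemma null_line_case H S : lie_group H S -> cohom1 S ->
  line_of_translations S (nu R) ->
  [\/ orbit_equivalent H (N_ell R), orbit_equivalent H (Nlam_ell 1) |
      exists lam : R, 0 <= lam /\ orbit_equivalent H (Alam_ell lam)].
Proof.
move=> HS cS Su.
have SY X : S X -> exists a b, X.1 = a *: Ya R + b *: Yn R.
  move=> SX; have [y Xy] := lie_so21 HS SX; exists (y 0 0), (y 1 0).
  have [b /cV3P] : exists b, cross y (nu R) = b *: nu R.
    apply: (line_invariant (v := X.2) HS Su); by rewrite -Xy -surjective_pairing.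
  rewrite nuE !coordE /= => -[h0 _ _].
  rewrite Xy YaE YnE -[y 1 0 *: _]Xi_scale -Xi_linear; congr Xi.
  by rewrite e1E nuE; apply/cV3P; rewrite !coordE /=; split; lra.
have [[Z [SZ [a [b [a0 EZ]]]]]|nZ] := pselect (exists Z, S Z /\
    exists a b, a != 0 /\ Z.1 = a *: Ya R + b *: Yn R).
- apply: Or33.
  have O1 := O21_unip (b / a); have I1 := Isom_lin O1.
  have det1 : \det (unip (b / a)) = 1 by rewrite det3E !mxE /=; field.
  have SYa X : S X -> exists c, X.1 = c *: (Ya R + (b / a) *: Yn R).
    move=> SX; have [a' [b' EX]] := SY X SX.
    have SZ' := lie_lin HS (- (a' / a)) SZ SX.
    have [D0|D0] := eqVneq (a * b' - a' * b) 0.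
      exists a'; rewrite EX scalerDr scalerA; congr (_ + _ *: _).
      have E : a * b' = a' * b by apply/eqP; rewrite -subr_eq0 D0.
      by apply: (mulfI a0); rewrite E; field.
    exfalso.
    have SN : exists v, S (Yn R, v).
      (* Eliminate Ya between Z and X; the determinant was assumed nonzero. *)
      pose W := (a / (a * b' - a' * b)) *: (- (a' / a) *: Z + X).
      exists W.2; have : S W := lieZ _ HS SZ'.
      congr S; rewrite [LHS]surjective_pairing; congr pair.
      rewrite /W /= EX EZ; move: (Ya R) (Yn R) => A B.
      by apply/matrixP => i j; rewrite !mxE; field; rewrite a0 D0.
    have [v Sv] := SN.
    have SA : exists u, S (Ya R, u).
      pose W := a^-1 *: (- b *: (Yn R, v) + Z).
      exists W.2; have : S W := lieZ _ HS (lie_lin HS _ Sv SZ).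
      congr S; rewrite [LHS]surjective_pairing; congr pair.
      rewrite /W /= EZ; move: (Ya R) (Yn R) => A B.
      by apply/matrixP => i j; rewrite !mxE; field.
    have [u SuA] := SA.
    exact: open_orbit_W2 HS cS Su SuA Sv.
  have HS1 := lie_group_conj I1 HS.
  have cS1 := cohom1_conj I1 cS.
  have Su1 : line_of_translations (Ad_set (unip (b / a), 0) S) (nu R).
    have := line_conj O1 Su.
    by congr line_of_translations; rewrite nuE; apply/cV3P; rewrite !coordE /=; split; field.
  have SY1 X : Ad_set (unip (b / a), 0) S X -> exists c, X.1 = c *: Ya R.
    rewrite Ad_set_lin // => -[X0 /SYa[c E] ->] /=; exists c.
    rewrite E YaE YnE [Xi (e1 R) + _]addrC -Xi_linear -scalemxAr -scalemxAl.
    rewrite Xi_conj // det1 scale1r; congr (_ *: Xi _).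
    by rewrite e1E nuE; apply/cV3P; rewrite !coordE /=; split; field.
  have [v Sv] := unit_rotational_part HS1 SY1 (line_rotational_part cS1 Su1).
  pose w : 'cV[R]_3 := vec3 0 (- v 2 0) (- v 1 0).
  have Sw : Ad_set (unip (b / a), 0) S (Ya R, Ya R *m w + v 0 0 *: e1 R + 0 *: nu R).
    move: Sv; congr (Ad_set _ _ _); congr pair; rewrite /w YaE mul_Xi e1E.
    by apply/cV3P; rewrite !coordE /=; split; ring.
  have It := Isom_trans w.
  have [lam [l0 E]] := Alam_case (lie_group_conj It HS1) (translate_line_algebra HS1 SY1 Su1 Sw).
  exists lam; split=> //; apply: (orbit_equivalent_conj I1).
  exact: orbit_equivalent_conj It E.
- have SY1 X : S X -> exists c, X.1 = c *: Yn R.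
    move=> SX; have [a [b EX]] := SY X SX; exists b; rewrite EX.
    have [->|a0] := eqVneq a 0; first by rewrite scale0r add0r.
    by exfalso; apply: nZ; exists X; split=> //; exists a, b.
  have [v Sv] := unit_rotational_part HS SY1 (line_rotational_part cS Su).
  pose w : 'cV[R]_3 := vec3 (- v 1 0) (v 0 0) 0.
  have Sw : S (Yn R, Yn R *m w + (v 1 0 + v 2 0) *: e3 R + 0 *: nu R).
    move: Sv; congr S; congr pair; rewrite /w YnE mul_Xi e3E nuE.
    by apply/cV3P; rewrite !coordE /=; split; ring.
  have It := Isom_trans w.
  have [E|E] := Nlam_case (lie_group_conj It HS) (translate_line_algebra HS SY1 Su Sw).
    by apply: Or31; exact: orbit_equivalent_conj It E.
  by apply: Or32; exact: orbit_equivalent_conj It E.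
Qed.

Definition no_translation S := forall v, S (0, v) -> v = 0.

Lemma graph_unique H S (A : 'M[R]_3) v w : lie_group H S -> no_translation S ->
  S (A, v) -> S (A, w) -> v = w.
Proof.
move=> HS S0 Sv Sw; apply/subr0_eq/S0; have := lie_lin HS (-1) Sw Sv.
congr S; congr pair; rewrite /= scaleN1r; first by rewrite addNr.
by rewrite addrC.
Qed.

(** Two elements whose velocities at some point are independent have independent
linear parts: a combination with vanishing linear part is a translation, hence
zero. *)
Lemma graph_pair H S : lie_group H S -> cohom1 S -> no_translation S ->
  exists y1 y2 v1 v2, [/\ S (Xi y1, v1), S (Xi y2, v2) & cross y1 y2 != 0].
Proof.
move=> HS [_ [p [u1 [u2 [n0 E]]]]] S0.
have [X1 SX1 E1] : exists2 X, S X & velocity X p = u1.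
  by apply/E; exists 1, 0; rewrite scale1r scale0r addr0.
have [X2 SX2 E2] : exists2 X, S X & velocity X p = u2.
  by apply/E; exists 0, 1; rewrite scale1r scale0r add0r.
have [y1 Ey1] := lie_so21 HS SX1; have [y2 Ey2] := lie_so21 HS SX2.
exists y1, y2, X1.2, X2.2; split; rewrite -?Ey1 -?Ey2 -?surjective_pairing //.
apply: contra_neq n0 => /cross_eq0[a [b [ab Ey]]].
have Z1 : (a *: X1 + b *: X2).1 = 0.
  rewrite /= Ey1 Ey2 -[b *: _]Xi_scale -Xi_linear Ey.
  by apply/M3P => u; rewrite mul_Xi mul0mx; apply/cV3P; rewrite !coordE /=; split; ring.
have Z2 : (a *: X1 + b *: X2).2 = 0.
  apply: S0; have := lie_lin HS a SX1 (lieZ b HS SX2).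
  by rewrite [X in S X]surjective_pairing Z1.
apply: (dep_cross ab); rewrite -E1 -E2 /velocity.
transitivity ((a *: X1 + b *: X2).1 *m p + (a *: X1 + b *: X2).2).
  by rewrite /= mulmxDl -!scalemxAl !scalerDr addrACA.
by rewrite Z1 Z2 mul0mx addr0.
Qed.

(** Without translations, [v] is a function of [y] in [S], and closure under brackets
says that it is a cocycle on so(2,1). Solving the nine linear equations given by
the pairs of basis vectors shows that it has the form [cross y w]; moving the
origin by [w] makes it vanish. The inclusion [H `<=` Isomo R] survives because a
translation does not change linear parts. *)
Lemma so21_case H S : lie_group H S -> H `<=` Isomo R -> no_translation S ->
  (forall y, exists v, S (Xi y, v)) ->
  orbit_equivalent H (linear_group (SOo21 R)).
Proof.
move=> HS HSO S0 Sall.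
have [f1 S1] := Sall (e1 R); have [f2 S2] := Sall (e2 R); have [f3 S3] := Sall (e3 R).
have br y1 y2 v1 v2 : S (Xi y1, v1) -> S (Xi y2, v2) ->
    S (Xi (cross y1 y2), cross y1 v2 - cross y2 v1).
  move=> Sy1 Sy2; have := lie_bracket HS Sy1 Sy2.
  by rewrite /bracket /= Xi_bracket !mul_Xi.
have c12 : f3 = - (cross (e1 R) f2 - cross (e2 R) f1).
  apply: (graph_unique HS S0 S3); have := lieZ (-1) HS (br _ _ _ _ S1 S2).
  congr S; congr pair => /=; last by rewrite scaleN1r.
  rewrite -Xi_scale; congr Xi; rewrite e1E e2E e3E.
  by apply/cV3P; rewrite !coordE /=; split; ring.
have c23 : f1 = cross (e2 R) f3 - cross (e3 R) f2.
  apply: (graph_unique HS S0 S1); have := br _ _ _ _ S2 S3.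
  congr S; congr pair; congr Xi; rewrite e1E e2E e3E.
  by apply/cV3P; rewrite !coordE /=; split; ring.
have c31 : f2 = cross (e3 R) f1 - cross (e1 R) f3.
  apply: (graph_unique HS S0 S2); have := br _ _ _ _ S3 S1.
  congr S; congr pair; congr Xi; rewrite e1E e2E e3E.
  by apply/cV3P; rewrite !coordE /=; split; ring.
move/cV3P: c12; move/cV3P: c23; move/cV3P: c31.
rewrite e1E e2E e3E !coordE /= => -[p1 p2 p3] [p4 p5 p6] [p7 p8 p9].
(* Read off from f1 = cross e1 w and f2 = cross e2 w. *)
pose w : 'cV[R]_3 := vec3 (f2 2 0) (- f1 2 0) (f2 0 0).
have w1 : f1 = cross (e1 R) w.
  by rewrite e1E /w; apply/cV3P; rewrite !coordE /=; split; lra.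
have w2 : f2 = cross (e2 R) w.
  by rewrite e2E /w; apply/cV3P; rewrite !coordE /=; split; lra.
have w3 : f3 = cross (e3 R) w.
  by rewrite e3E /w; apply/cV3P; rewrite !coordE /=; split; lra.
have Sw y : S (Xi y, cross y w).
  have := lie_lin HS (y 0 0) S1 (lie_lin HS (y 1 0) S2 (lieZ (y 2 0) HS S3)).
  congr S; rewrite [LHS]surjective_pairing; congr pair => /=.
    rewrite -[_ *: Xi (e3 R)]Xi_scale -!Xi_linear; congr Xi.
    by rewrite e1E e2E e3E; apply/cV3P; rewrite !coordE /=; split; ring.
  rewrite w1 w2 w3 e1E e2E e3E.
  by apply/cV3P; rewrite !(vec3s, mxE) /=; split; ring.
have It := Isom_trans w; have HSt := lie_group_conj It HS.
apply: (orbit_equivalent_conj It); apply: orbits_equivalent; congr orbits.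
apply: (SO_eq HSt) => [h|X].
  rewrite /conj_set /= => /HSO; rewrite /Isomo /conj /affM /affV /=.
  by rewrite !invmx1 mul1mx mulmx1.
rewrite Ad_set_trans; split=> [SX|[y ->]]; last by rewrite /= add0r mul_Xi.
have [y /= Ey] := lie_so21 HS SX; exists y.
rewrite [LHS]surjective_pairing Ey; congr pair.
have := graph_unique HS S0 SX; rewrite Ey mul_Xi => /(_ _ (Sw y)).
by rewrite -[RHS]add0r => /addIr.
Qed.

(** The bracket [[Ya, Yn] = Yn] determines enough of the two translation parts to
write them as [cross e1 w] and [cross nu w] for a common [w]. *)
Lemma borel_case H S u v : lie_group H S -> no_translation S ->
  (forall X, S X -> exists a b, X.1 = Xi (a *: e1 R + b *: nu R)) ->
  S (Ya R, u) -> S (Yn R, v) -> orbit_equivalent H (AN R).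
Proof.
move=> HS S0 SY SA SN.
have := lie_bracket HS SA SN; rewrite /bracket /= YaE YnE Xi_bracket !mul_Xi => Sb.
have cE : cross (e1 R) (nu R) = nu R.
  by rewrite e1E nuE; apply/cV3P; rewrite !coordE /=; split; ring.
rewrite cE -YnE in Sb; move: (graph_unique HS S0 SN Sb) => /cV3P.
rewrite e1E nuE !coordE /= => -[h0 h1 h2].
(* Read off from u = cross e1 w and v = cross nu w. *)
pose w : 'cV[R]_3 := vec3 (v 2 0) (- u 2 0) (- u 1 0).
have wA : cross (e1 R) w = u.
  by rewrite /w e1E; apply/cV3P; rewrite !coordE /=; split; lra.
have wN : cross (nu R) w = v.
  by rewrite /w nuE; apply/cV3P; rewrite !coordE /=; split; lra.
have Sw a b : S (Xi (a *: e1 R + b *: nu R), cross (a *: e1 R + b *: nu R) w).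
  have := lie_lin HS a SA (lieZ b HS SN); congr S.
  rewrite [LHS]surjective_pairing; congr pair => /=.
    by rewrite YaE YnE -[b *: Xi _]Xi_scale -Xi_linear.
  by rewrite -wA -wN; apply/cV3P; rewrite !(vec3s, mxE) /=; split; ring.
have It := Isom_trans w; have HSt := lie_group_conj It HS.
apply: (orbit_equivalent_conj It); apply: orbits_equivalent; congr orbits.
apply: (AN_eq HSt) => X.
rewrite Ad_set_trans; split=> [SX|[a [b ->]]]; last by rewrite /= add0r mul_Xi.
have [a [b /= E]] := SY _ SX; exists a, b.
rewrite [LHS]surjective_pairing E; congr pair.
have := graph_unique HS S0 SX; rewrite E mul_Xi => /(_ _ (Sw a b)).
by rewrite -[RHS]add0r => /addIr.
Qed.

(** If [y1], [y2] are independent linear parts, an element outside the plane they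
span would make every [y] occur. So, unless that happens, this plane is the space
of all linear parts; it contains its own normal [n], which is therefore null, and
O(2,1) moves it to the plane of [e1] and [nu]. *)
Lemma graph_case H S : lie_group H S -> cohom1 S -> H `<=` Isomo R ->
  no_translation S ->
  orbit_equivalent H (linear_group (SOo21 R)) \/ orbit_equivalent H (AN R).
Proof.
move=> HS cS HSO S0; have [y1 [y2 [v1 [v2 [S1 S2 n0]]]]] := graph_pair HS cS S0.
set n := cross y1 y2 in n0.
have [Sall|nall] := pselect (forall y, exists v, S (Xi y, v)).
  by left; exact: so21_case Sall.
right.
have Sn y v : S (Xi y, v) -> lorentz n y = 0.
  move=> Sy; apply: contrapT => /eqP ny; apply: nall => q.
  have [a [b [c ->]]] := cramer ny q.
  have := lie_lin HS a S1 (lie_lin HS b S2 (lieZ c HS Sy)).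
  set W := _ + _ => SW; exists W.2; move: SW; congr S.
  rewrite [LHS]surjective_pairing; congr pair.
  by rewrite /W /= -[c *: _]Xi_scale -!Xi_linear addrA.
have nn : lorentz n n = 0.
  have := lie_bracket HS S1 S2; rewrite /bracket /= Xi_bracket; exact: Sn.
have Sperp y : lorentz n y = 0 -> exists v, S (Xi y, v).
  move=> ny; have [a [b ->]] := span_of_orthogonal n0 ny.
  have := lie_lin HS a S1 (lieZ b HS S2).
  set W := _ + _ => SW; exists W.2; move: SW; congr S.
  rewrite [LHS]surjective_pairing; congr pair.
  by rewrite /W /= -[b *: _]Xi_scale -!Xi_linear.
have [x Ox [c c0 xn]] := O21_normal_form n0.
have {}xn : x *m n = c *: nu R.
  have := Ox n n; rewrite nn; case: xn => // ->; rewrite ?e1E ?e3E /lorentz !coordE /=.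
    move=> E; suff /eqP : c ^+ 2 = 0 by rewrite sqrf_eq0 (negPf c0).
    by rewrite expr2; lra.
  move=> E; suff /eqP : c ^+ 2 = 0 by rewrite sqrf_eq0 (negPf c0).
  by rewrite expr2; lra.
have xU := O21_unit Ox; have Ix := Isom_lin Ox; have HSx := lie_group_conj Ix HS.
have d2 := O21_det Ox.
have S0x : no_translation (Ad_set (x, 0) S).
  move=> v; have [Sv _] := Ad_set_translations S v Ox => /Sv /S0 /(congr1 (mulmx x)).
  by rewrite mulKVmx // mulmx0.
have Sx y : lorentz (nu R) y = 0 -> exists v, Ad_set (x, 0) S (Xi y, v).
  move=> ny; have [|v Sv] := Sperp (\det x *: (invmx x *m y)).
    have : lorentz (x *m n) y = 0.
      by rewrite xn lorentzZl ny mulr0.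
    by rewrite -{1}[y](mulKVmx xU) Ox lorentzZr => ->; rewrite mulr0.
  exists (x *m v); apply/Ad_set_lin => //; exists (Xi (\det x *: (invmx x *m y)), v) => //=.
  by rewrite Xi_conj // -scalemxAr mulKVmx // -Xi_scale scalerA -expr2 d2 scale1r.
have nu0 (a b : R) : lorentz (nu R) (a *: e1 R + b *: nu R) = 0.
  by rewrite e1E nuE /lorentz !coordE /=; ring.
have [u Su] : exists u, Ad_set (x, 0) S (Ya R, u).
  rewrite YaE; apply: Sx; have := nu0 1 0; by rewrite scale1r scale0r addr0.
have [v Sv] : exists v, Ad_set (x, 0) S (Yn R, v).
  rewrite YnE; apply: Sx; have := nu0 0 1; by rewrite scale1r scale0r add0r.
apply: (orbit_equivalent_conj Ix); apply: (borel_case HSx S0x _ Su Sv) => X.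
rewrite Ad_set_lin // => -[[A v0] SX ->] /=.
have [y /= Ey] := lie_so21 HS SX; rewrite Ey in SX *.
have ny := Sn _ _ SX.
have : lorentz (nu R) (x *m y) = 0.
  by have := Ox n y; rewrite ny xn lorentzZl => E; apply: (mulfI c0); rewrite mulr0.
move: (x *m y) (Xi_conj y Ox) => z -> nz.
exists (\det x * z 0 0), (\det x * z 1 0); rewrite -Xi_scale; congr Xi.
move: nz; rewrite nuE e1E /lorentz !coordE /= => nz.
by apply/cV3P; rewrite !coordE /=; split; [ring|ring|]; nra.
Qed.

End Final.

Theorem theorem6p1 (R : realType) (H : set (aff R))
  (H_Lie : connected_Lie_subgroup H) (H_sub : H `<=` Isomo R)
  (H_coh : cohomogeneity H 1) :
  [\/ [\/ orbit_equivalent H (translations (R2 R)),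
          orbit_equivalent H (translations (L2 R)) |
          orbit_equivalent H (translations (W2 R))],
      [\/ orbit_equivalent H (K_Re3 R),
          orbit_equivalent H (A_Re1 R),
          orbit_equivalent H (N_ell R) |
          orbit_equivalent H (Nlam_ell 1) \/
          exists lam : R, 0 <= lam /\ orbit_equivalent H (Alam_ell lam)] |
      orbit_equivalent H (linear_group (SOo21 R)) \/
      orbit_equivalent H (AN R)].
Proof.
have HS := lie_groupP H_Lie; have cS := cohom1P H_coh.
move: (lie_algebra H) HS cS => S HS cS.
have [[u [v [Su Sv uv]]]|nT] := pselect (exists u v, [/\ S (0, u), S (0, v) & cross u v != 0]).
  by apply: Or31; exact: plane_case HS cS Su Sv uv.
have [[u [Su u0]]|nt] := pselect (exists u, S (0, u) /\ u != 0); last first.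
  apply: Or33; apply: graph_case HS cS H_sub _ => v Sv.
  by apply/eqP/negP => /negP v0; apply: nt; exists v.
apply: Or32.
have Su1 : line_of_translations S u.
  move=> v; split=> [Sv|[b ->]]; last first.
    by have := lieZ b HS Su; congr S; congr pair; rewrite scaler0.
  have : cross u v = 0 by apply/eqP/negP => /negP uv; apply: nT; exists u, v.
  move/cross_eq0 => [a [b [ab E]]].
  have [b0|b0] := eqVneq b 0.
    move: ab E; rewrite b0 eqxx orbF scale0r addr0 => a0 /eqP.
    by rewrite scaler_eq0 (negPf a0) (negPf u0).
  exists (- (a / b)); apply: (scalerI b0).
  by rewrite scalerA mulrN mulrCA divff // mulr1 scaleNr; apply/eqP; rewrite -addr_eq0 addrC E.
have [x Ox [c c0 xu]] := O21_normal_form u0.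
have Ix := Isom_lin Ox; have HSx := lie_group_conj Ix HS.
have cSx := cohom1_conj Ix cS; have Sux := line_conj Ox Su1.
case: xu => xu; rewrite xu in Sux; have {}Sux := line_scale c0 Sux.
- by apply: Or41; apply: (orbit_equivalent_conj Ix); exact: line_e3_case cSx Sux.
- by apply: Or42; apply: (orbit_equivalent_conj Ix); exact: line_e1_case cSx Sux.
- have [E|E|[lam [l0 E]]] := null_line_case HSx cSx Sux.
  + by apply: Or43; exact: orbit_equivalent_conj Ix E.
  + by apply: Or44; left; exact: orbit_equivalent_conj Ix E.
  + by apply: Or44; right; exists lam; split=> //; exact: orbit_equivalent_conj Ix E.
Qed.
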